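(* Let $W:[0,1]\to\mathbb C$ be $(\sigma_*,2)$-Gevrey regular, let $0<\sigma<\sigma'<\sigma_*$ and $s\in\Omega_\sigma\cap\Omega_{\sigma'}$. Then $\dim\{u\in\mathcal D^\sigma:\mathcal L_su=0\}=\dim\{u\in\mathcal D^{\sigma'}:\mathcal L_su=0\}$.
   Context: Let $I=(0,1)$. A function $u\in C^\infty(\overline I)$ is $(\sigma,k)$-Gevrey regular ($\sigma,k>0$) if there is $C>0$ with $\sup_{x\in I}|u^{(n)}(x)|\le C\sigma^{-n}(n!)^k$ for all $n\ge0$. For $\sigma>0$, $u\in C^\infty(\overline I)$, $k\in\{0,1,2\}$: $|u|^{0}_{\sigma,k,0}=\big(\sum_{n=0}^\infty\frac{\sigma^{2n}}{n!^2(n+1)!^2}n^{k}\int_0^1(x/\sigma)^k|\partial_x^nu|^2dx\big)^{1/2}$ (with $0^0:=1$), $\|u\|_{\sigma,0,0}=|u|^0_{\sigma,0,0}$, $[u]^0_\sigma=(\sum_{n=0}^\infty\frac{\sigma^{2n+1}}{n!^2(n+1)!^2}|u^{(n)}(0)|^2)^{1/2}$. $X^\sigma=\{u\in C^\infty(\overline I):u(1)=0,\ \|\partial_xu\|_{\sigma,0,0}+|\partial_xu|^0_{\sigma,1,0}+|\partial_xu|^0_{\sigma,2,0}+[\partial_xu]^0_\sigma<\infty\}$, $Y^\sigma=\{u\in C^\infty(\overline I):\|u\|_{\sigma,0,0}+|u|^0_{\sigma,1,0}+[u]^0_\sigma<\infty\}$. $\Omega^1_\sigma=\{s:\Re s\le0,\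 \sigma<|\Im s|\}\cup\{s:\Re s>0,\ \sigma<|s|\}$; $\Omega^2_\sigma=\{s:\ \sigma<|s|+\Re s,\ \sigma>\frac{-\Re(s)|s|}{2(|s|+\Re s)}\}$; $\Omega^3_\sigma=\{s\neq0:\ \sigma(|s|-\sigma+\Re s)-(\sigma(1+\frac{\Re s}{|s|})+\frac12\Re s)^2>0\}$; $\Omega_\sigma=\Omega^1_\sigma\cap(\Omega^2_\sigma\cup\Omega^3_\sigma)$. $\mathcal L_su=\frac{d}{dx}(x^2\frac{du}{dx})+s\frac{du}{dx}-Wu$ and $\mathcal D^\sigma=\{u\in X^\sigma:\mathcal L_su\in Y^\sigma\}$ (independent of $s\in\Omega_\sigma$). It is known that $\mathcal L_s:\mathcal D^\sigma\to Y^\sigma$ is Fredholm of index $0$ for $s\in\Omega_\sigma$. *)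

(* Defs.v *)
From Stdlib Require Import Reals Arith.
Open Scope R_scope.

Definition Cx : Type := (R * R)%type.
Definition Cre (z : Cx) : R := fst z.
Definition Cim (z : Cx) : R := snd z.
Definition C0 : Cx := (0, 0).
Definition RtoC (r : R) : Cx := (r, 0).
Definition Cadd (z w : Cx) : Cx := (Cre z + Cre w, Cim z + Cim w).
Definition Csub (z w : Cx) : Cx := (Cre z - Cre w, Cim z - Cim w).
Definition Cmul (z w : Cx) : Cx :=
  (Cre z * Cre w - Cim z * Cim w, Cre z * Cim w + Cim z * Cre w).
Definition Cscal (r : R) (z : Cx) : Cx := (r * Cre z, r * Cim z).
Definition Cnorm2 (z : Cx) : R := Cre z ^ 2 + Cim z ^ 2.
Definition Cmod (z : Cx) : R := sqrt (Cnorm2 z).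

Fixpoint Csum (f : nat -> Cx) (d : nat) : Cx :=
  match d with
  | O => C0
  | S d' => Cadd (Csum f d') (f d')
  end.

Definition in01 (x : R) : Prop := 0 <= x <= 1.

(* one-sided at the endpoints *)
Definition has_deriv01 (f : R -> Cx) (l : Cx) (x : R) : Prop :=
  forall eps, 0 < eps -> exists delta, 0 < delta /\
    forall h, h <> 0 -> Rabs h < delta -> in01 (x + h) ->
      Cmod (Csub (Cscal (/ h) (Csub (f (x + h)) (f x))) l) < eps.

Definition has_deriv01R (f : R -> R) (l : R) (x : R) : Prop :=
  forall eps, 0 < eps -> exists delta, 0 < delta /\
    forall h, h <> 0 -> Rabs h < delta -> in01 (x + h) ->
      Rabs ((f (x + h) - f x) / h - l) < eps.

(* D is the sequence of derivatives of u on [0,1]: D 0 = u, (D n)' = D (n+1).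
   Existence of such D for u is exactly u ∈ Cx^∞([0,1]) (closed interval). *)
Definition derivs (u : R -> Cx) (D : nat -> R -> Cx) : Prop :=
  (forall x, in01 x -> D 0%nat x = u x) /\
  (forall n x, in01 x -> has_deriv01 (D n) (D (S n) x) x).

Definition smooth01 (u : R -> Cx) : Prop := exists D, derivs u D.

(* ∫_0^1 g = l  (for continuous g, via an antiderivative) *)
Definition integral01 (g : R -> R) (l : R) : Prop :=
  exists F : R -> R, (forall x, in01 x -> has_deriv01R F (g x) x) /\ l = F 1 - F 0.

(* a series of nonnegative reals is finite *)
Definition series_finite (a : nat -> R) : Prop :=
  exists M, forall N, sum_f_R0 a N <= M.

Definition gevrey_regular (sigma k : R) (u : R -> Cx) : Prop :=
  exists D, derivs u D /\
  exists K, forall n x, in01 x ->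
    Cmod (D n x) <= K * (/ sigma) ^ n * Rpower (INR (fact n)) k.

Definition gcoef (sigma : R) (n : nat) : R :=
  sigma ^ (2 * n) / (INR (fact n) ^ 2 * INR (fact (S n)) ^ 2).

(* |v|^0_{sigma,k,0} < ∞, where D is the derivative sequence of v.
   Weight n^k (x/sigma)^k, with 0^0 = 1 (Stdlib pow: r ^ 0 = 1). *)
Definition norm_finite (sigma : R) (k : nat) (D : nat -> R -> Cx) : Prop :=
  exists I : nat -> R,
    (forall n, integral01
       (fun x => INR n ^ k * (x / sigma) ^ k * Cnorm2 (D n x)) (I n)) /\
    series_finite (fun n => gcoef sigma n * I n).

Definition bdry_finite (sigma : R) (D : nat -> R -> Cx) : Prop :=
  series_finite (fun n => sigma ^ (2 * n + 1) /
     (INR (fact n) ^ 2 * INR (fact (S n)) ^ 2) * Cnorm2 (D n 0)).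

Definition shiftD (D : nat -> R -> Cx) : nat -> R -> Cx := fun n => D (S n).

Definition inX_D (sigma : R) (u : R -> Cx) (D : nat -> R -> Cx) : Prop :=
  derivs u D /\ u 1 = C0 /\
  norm_finite sigma 0 (shiftD D) /\ norm_finite sigma 1 (shiftD D) /\
  norm_finite sigma 2 (shiftD D) /\ bdry_finite sigma (shiftD D).

Definition inX (sigma : R) (u : R -> Cx) : Prop := exists D, inX_D sigma u D.

Definition inY (sigma : R) (v : R -> Cx) : Prop :=
  exists E, derivs v E /\ norm_finite sigma 0 E /\ norm_finite sigma 1 E /\
            bdry_finite sigma E.

(* L_s u = (x^2 u')' + s u' - W u = x^2 u'' + 2x u' + s u' - W u *)
Definition Lop (s : Cx) (W : R -> Cx) (D : nat -> R -> Cx) : R -> Cx :=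
  fun x => Csub (Cadd (Cadd (Cscal (x ^ 2) (D 2%nat x)) (Cscal (2 * x) (D 1%nat x)))
                      (Cmul s (D 1%nat x)))
                (Cmul (W x) (D 0%nat x)).

Definition inDom (sigma : R) (s : Cx) (W : R -> Cx) (u : R -> Cx) : Prop :=
  exists D, inX_D sigma u D /\ inY sigma (Lop s W D).

Definition in_kernel (sigma : R) (s : Cx) (W : R -> Cx) (u : R -> Cx) : Prop :=
  inDom sigma s W u /\
  exists D, derivs u D /\ forall x, in01 x -> Lop s W D x = C0.

(* the (complex) subspace P of functions on [0,1] has dimension d
   (functions identified when equal on [0,1]) *)
Definition has_dim (P : (R -> Cx) -> Prop) (d : nat) : Prop :=
  exists b : nat -> R -> Cx,
    (forall i, (i < d)%nat -> P (b i)) /\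
    (forall c : nat -> Cx,
        (forall x, in01 x -> Csum (fun i => Cmul (c i) (b i x)) d = C0) ->
        forall i, (i < d)%nat -> c i = C0) /\
    (forall u, P u -> exists c : nat -> Cx,
        forall x, in01 x -> u x = Csum (fun i => Cmul (c i) (b i x)) d).

Definition Omega1 (sigma : R) (s : Cx) : Prop :=
  (Cre s <= 0 /\ sigma < Rabs (Cim s)) \/ (0 < Cre s /\ sigma < Cmod s).

Definition Omega2 (sigma : R) (s : Cx) : Prop :=
  sigma < Cmod s + Cre s /\
  sigma > - (Cre s) * Cmod s / (2 * (Cmod s + Cre s)).

Definition Omega3 (sigma : R) (s : Cx) : Prop :=
  s <> C0 /\
  sigma * (Cmod s - sigma + Cre s)
    - (sigma * (1 + Cre s / Cmod s) + / 2 * Cre s) ^ 2 > 0.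

Definition Omega (sigma : R) (s : Cx) : Prop :=
  Omega1 sigma s /\ (Omega2 sigma s \/ Omega3 sigma s).

(* Main.v *)
(** A function [u] in the kernel for the smaller radius [sigma] lies in the kernel for
    [sigma'].  Differentiating [L_s u = 0] shows that the derivatives [w_n] of [u'],
    normalised by weights [tau_1 ... tau_n / (n! (n+1)!)], satisfy, with [y = (n+1) x],
    [y^2 w_(n+1) / tau + (2 y + s) w_n + tau w_(n-1) = O(1/n)], while [w_n'] is of order
    [n^2 w_(n+1)].  Because [s] lies in both regions, a suitable multiplier gives an energy
    inequality [c Z_n <= Phi_n - Phi_(n+1) + O(1/n)] for
    [Z_n = int (1 + y^2) |w_n|^2 + |w_n(0)|^2].  Choosing radii [tau_n] that equal [sigma']
    up to order [N] and then decrease slowly to [sigma] makes all sums finite a priori; the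
    bound on [sum Z_n] is uniform in [N], and letting [N] tend to infinity gives regularity
    at radius [sigma'].  Hence both kernels coincide. *)

From Stdlib Require Import Reals Arith Lra Lia.
From Coquelicot Require Import Rcomplements Hierarchy Continuity Derive RInt.
From Coquelicot Require Import RInt_analysis ElemFct AutoDerive.
Require Import Defs.
Open Scope R_scope.

(** * Calculus on the closed unit interval *)

(** Heuristics behind the multipliers and the conditions on [s]: a profile [w_n] proportional to
    [exp (i n^2 xi x)] forces [w_(n+1) = i xi tau w_n] to leading order, so a mode must satisfy
    [i y^2 xi + 2 y + s - i / xi = 0]. For [Re s > 0] the real part never vanishes. For
    [Re s = - a <= 0] it vanishes only at [y = a / 2], where [a^2 xi^2 / 4 + xi Im s = 1]. The
    bounds [tau < |Im s|] and [a^2 < 4 tau (tau + |Im s|)] imply that no such [xi] has modulus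
    [1 / tau], so every mode strictly grows or strictly decays in [n]. The first bound is hardest at
    the largest radius, the second at the smallest; holding at the two end radii, they hold in
    between, with constants independent of the sequence of radii. An energy inequality alone cannot
    exclude the growing modes: this is done by the decay of the energy at infinity, which is known
    only at radius [sigma] and is the reason for tapering. *)

Definition clamp (x : R) : R := Rmax 0 (Rmin 1 x).

Lemma clamp_in01 x : in01 (clamp x).
Proof.
  unfold clamp, in01, Rmax, Rmin.
  destruct (Rle_dec 1 x); destruct Rle_dec; lra.
Qed.

Lemma clamp_id x : in01 x -> clamp x = x.
Proof.
  unfold clamp, in01, Rmax, Rmin; intros H.
  destruct (Rle_dec 1 x); destruct Rle_dec; lra.
Qed.

Lemma clamp_lipschitz x y : Rabs (clamp x - clamp y) <= Rabs (x - y).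
Proof.
  unfold clamp, Rmax, Rmin.
  destruct (Rle_dec 1 x), (Rle_dec 1 y); repeat destruct Rle_dec;
    unfold Rabs; repeat destruct Rcase_abs; lra.
Qed.

(* Precomposing with [clamp] turns continuity relative to [0,1] into continuity on R. *)
Definition cont01 (f : R -> R) : Prop :=
  forall x, continuous (fun t => f (clamp t)) x.

Lemma continuous_clamp x : continuous clamp x.
Proof.
  apply filterlim_locally; intros eps.
  exists eps; intros y Hy.
  apply Rle_lt_trans with (2 := Hy).
  apply clamp_lipschitz.
Qed.

Lemma cont01_const (c : R) : cont01 (fun _ => c).
Proof. intros x; apply continuous_const. Qed.

Lemma cont01_id : cont01 (fun x => x).
Proof. intros x; apply continuous_clamp. Qed.

Lemma cont01_plus f g : cont01 f -> cont01 g -> cont01 (fun x => f x + g x).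
Proof.
  intros Hf Hg x.
  apply (continuous_plus (fun t => f (clamp t)) (fun t => g (clamp t)));
    [apply Hf | apply Hg].
Qed.

Lemma cont01_minus f g : cont01 f -> cont01 g -> cont01 (fun x => f x - g x).
Proof.
  intros Hf Hg x.
  apply (continuous_minus (fun t => f (clamp t)) (fun t => g (clamp t)));
    [apply Hf | apply Hg].
Qed.

Lemma cont01_opp f : cont01 f -> cont01 (fun x => - f x).
Proof. intros Hf x; apply (continuous_opp (fun t => f (clamp t))), Hf. Qed.

Lemma cont01_mult f g : cont01 f -> cont01 g -> cont01 (fun x => f x * g x).
Proof.
  intros Hf Hg x.
  apply (continuous_mult (fun t => f (clamp t)) (fun t => g (clamp t)));
    [apply Hf | apply Hg].
Qed.

Lemma cont01_pow f n : cont01 f -> cont01 (fun x => f x ^ n).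
Proof.
  intros Hf; induction n as [|n IH]; simpl.
  - apply cont01_const.
  - apply cont01_mult; assumption.
Qed.

Lemma cont01_sqrt f : cont01 f -> cont01 (fun x => sqrt (f x)).
Proof.
  intros Hf x.
  apply (continuous_comp (fun t => f (clamp t)) sqrt).
  - apply Hf.
  - apply continuous_sqrt.
Qed.

Lemma cont01_sum f n :
  (forall k, cont01 (f k)) -> cont01 (fun x => sum_f_R0 (fun k => f k x) n).
Proof.
  intros Hf; induction n as [|n IH]; simpl.
  - apply Hf.
  - apply cont01_plus; auto.
Qed.

Ltac cont01_tac :=
  repeat match goal with
  | |- cont01 (fun _ => ?c) => apply (cont01_const c)
  | |- cont01 (fun x => x) => apply cont01_id
  | |- cont01 (fun x => @?f x + @?g x) => apply (cont01_plus f g)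
  | |- cont01 (fun x => @?f x - @?g x) => apply (cont01_minus f g)
  | |- cont01 (fun x => - @?f x) => apply (cont01_opp f)
  | |- cont01 (fun x => @?f x * @?g x) => apply (cont01_mult f g)
  | |- cont01 (fun x => @?f x / ?c) => apply (cont01_mult f (fun _ => / c))
  | |- cont01 (fun x => @?f x ^ ?n) => apply (cont01_pow f n)
  | |- cont01 (fun x => sqrt (@?f x)) => apply (cont01_sqrt f)
  | |- cont01 (fun x => sum_f_R0 (fun k => @?f k x) ?n) => apply (cont01_sum f n); intros
  | H : cont01 ?f |- cont01 (fun x => ?f x) => exact H
  | H : cont01 ?f |- cont01 ?f => exact H
  | H : forall _, cont01 _ |- _ => exact (H _)
  end.

(** * Integrals over the unit interval and the fundamental theorem of calculus *)

Definition I01 (f : R -> R) : R := RInt f 0 1.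

Lemma ex_RInt_cont01 f : cont01 f -> ex_RInt f 0 1.
Proof.
  intros Hf.
  apply ex_RInt_ext with (fun t => f (clamp t)).
  - rewrite Rmin_left, Rmax_right by lra; intros x Hx.
    rewrite clamp_id by (unfold in01; lra); reflexivity.
  - apply (@ex_RInt_continuous R_CompleteNormedModule); intros z _; apply Hf.
Qed.

Lemma I01_ext f g : (forall x, in01 x -> f x = g x) -> I01 f = I01 g.
Proof.
  intros E; apply RInt_ext.
  rewrite Rmin_left, Rmax_right by lra; intros x Hx; apply E; unfold in01; lra.
Qed.

Lemma I01_plus f g : cont01 f -> cont01 g ->
  I01 (fun x => f x + g x) = I01 f + I01 g.
Proof.
  intros Hf Hg; apply (@RInt_plus R_CompleteNormedModule);
    apply ex_RInt_cont01; assumption.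
Qed.

Lemma I01_minus f g : cont01 f -> cont01 g ->
  I01 (fun x => f x - g x) = I01 f - I01 g.
Proof.
  intros Hf Hg; apply (@RInt_minus R_CompleteNormedModule);
    apply ex_RInt_cont01; assumption.
Qed.

Lemma I01_scal c f : cont01 f -> I01 (fun x => c * f x) = c * I01 f.
Proof.
  intros Hf; apply (@RInt_scal R_CompleteNormedModule).
  apply ex_RInt_cont01; assumption.
Qed.

Lemma I01_le f g : cont01 f -> cont01 g ->
  (forall x, in01 x -> f x <= g x) -> I01 f <= I01 g.
Proof.
  intros Hf Hg H; apply RInt_le; try (apply ex_RInt_cont01; assumption); [lra|].
  intros x Hx; apply H; unfold in01; lra.
Qed.

Lemma I01_const c : I01 (fun _ => c) = c.
Proof.
  unfold I01; rewrite RInt_const; unfold scal; simpl; unfold mult; simpl; lra.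
Qed.

Lemma I01_ge0 f : cont01 f -> (forall x, in01 x -> 0 <= f x) -> 0 <= I01 f.
Proof.
  intros Hf H; rewrite <- (I01_const 0).
  apply I01_le; [apply cont01_const | assumption | assumption].
Qed.

Lemma I01_primitive f x : cont01 f ->
  is_derive (fun t => RInt (fun s => f (clamp s)) 0 t) x (f (clamp x)).
Proof.
  intros Hf.
  apply (is_derive_RInt (fun s => f (clamp s))
           (fun t => RInt (fun s => f (clamp s)) 0 t) 0 x).
  - exists posreal_one; intros y _.
    apply (@RInt_correct R_CompleteNormedModule).
    apply (@ex_RInt_continuous R_CompleteNormedModule); intros z _; apply Hf.
  - apply Hf.
Qed.

(** Differentiability of [F] is known only inside the interval. The mean value theorem is therefore
    applied to [F] after [clamp] minus the primitive of [f] after [clamp], which is continuous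
    everywhere and has zero derivative inside. *)
Lemma I01_derive F f : cont01 F -> cont01 f ->
  (forall x, 0 < x < 1 -> is_derive F x (f x)) -> I01 f = F 1 - F 0.
Proof.
  intros HF Hf HD.
  set (P := fun t => RInt (fun s => f (clamp s)) 0 t).
  set (G := fun t => F (clamp t) - P t).
  assert (HG : forall x, 0 < x < 1 -> is_derive G x 0).
  { intros x Hx.
    replace 0 with (f x - f (clamp x))
      by (rewrite clamp_id by (unfold in01; lra); ring).
    apply (is_derive_minus (fun t => F (clamp t)) P).
    - apply is_derive_ext_loc with F; [|apply HD; assumption].
      assert (Hd : 0 < Rmin x (1 - x)) by (apply Rmin_pos; lra).
      exists (mkposreal _ Hd); intros y Hy.
      rewrite clamp_id; [reflexivity|].
      unfold ball in Hy; simpl in Hy; unfold AbsRing_ball, abs, minus, plus, opp in Hy;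
        simpl in Hy.
      pose proof (Rmin_l x (1 - x)); pose proof (Rmin_r x (1 - x)).
      unfold in01; unfold Rabs in Hy; destruct Rcase_abs in Hy; lra.
    - apply I01_primitive; assumption. }
  assert (E : G 1 = G 0).
  { destruct (MVT_gen G 0 1 (fun _ => 0)) as [c [_ Hc]].
    - rewrite Rmin_left, Rmax_right by lra; assumption.
    - intros x _.
      apply continuity_pt_filterlim.
      apply (continuous_minus (fun t => F (clamp t)) P).
      + apply HF.
      + apply (@ex_derive_continuous R_AbsRing R_NormedModule).
        exists (f (clamp x)); apply I01_primitive; assumption.
    - lra. }
  unfold G in E; rewrite !clamp_id in E by (unfold in01; lra).
  assert (E0 : P 0 = 0) by (unfold P; rewrite RInt_point; reflexivity).
  assert (E1 : P 1 = I01 f).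
  { unfold P; apply I01_ext; intros x Hx; rewrite clamp_id; auto. }
  lra.
Qed.

(** Near a point the difference quotient is at most [|f'| + 1] in absolute value, so increments are
    controlled linearly; [clamp] is 1-Lipschitz and carries this over to the whole line. *)
Lemma has_deriv01R_cont01 f f' :
  (forall x, in01 x -> has_deriv01R f (f' x) x) -> cont01 f.
Proof.
  intros H x; apply filterlim_locally; intros eps.
  pose proof (clamp_in01 x) as Hc.
  destruct (H _ Hc 1 Rlt_0_1) as [d [Hd Hb]].
  set (L := Rabs (f' (clamp x)) + 1).
  assert (HL : 0 < L) by (unfold L; pose proof (Rabs_pos (f' (clamp x))); lra).
  assert (He : 0 < Rmin d (eps / L)).
  { apply Rmin_pos; [assumption|]; apply Rdiv_lt_0_compat; [apply cond_pos|assumption]. }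
  exists (mkposreal _ He); intros y Hy.
  change (Rabs (y - x) < Rmin d (eps / L)) in Hy.
  change (Rabs (f (clamp y) - f (clamp x)) < eps).
  pose proof (clamp_lipschitz y x) as Hl.
  pose proof (Rmin_l d (eps / L)); pose proof (Rmin_r d (eps / L)).
  set (h := clamp y - clamp x) in *.
  destruct (Req_dec h 0) as [E|E].
  { replace (clamp y) with (clamp x) by (unfold h in E; lra).
    rewrite Rminus_diag, Rabs_R0; apply cond_pos. }
  specialize (Hb h E ltac:(lra)).
  replace (clamp x + h) with (clamp y) in Hb by (unfold h; ring).
  specialize (Hb (clamp_in01 y)).
  assert (Hq : Rabs ((f (clamp y) - f (clamp x)) / h) < L).
  { unfold L.
    pose proof (Rabs_triang ((f (clamp y) - f (clamp x)) / h - f' (clamp x)) (f' (clamp x))) as T.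
    replace ((f (clamp y) - f (clamp x)) / h - f' (clamp x) + f' (clamp x))
      with ((f (clamp y) - f (clamp x)) / h) in T by ring.
    lra. }
  replace (f (clamp y) - f (clamp x)) with ((f (clamp y) - f (clamp x)) / h * h)
    by (field; assumption).
  rewrite Rabs_mult.
  assert (Hh : Rabs h < eps / L) by lra.
  apply Rle_lt_trans with (L * Rabs h).
  - apply Rmult_le_compat_r; [apply Rabs_pos | lra].
  - apply Rlt_le_trans with (L * (eps / L)); [apply Rmult_lt_compat_l; assumption|].
    right; field; lra.
Qed.

Lemma has_deriv01R_is_derive f l x : 0 < x < 1 -> has_deriv01R f l x -> is_derive f x l.
Proof.
  intros Hx H; apply is_derive_Reals; intros eps Heps.
  destruct (H eps Heps) as [d [Hd Hb]].
  assert (He : 0 < Rmin d (Rmin x (1 - x))) by (repeat apply Rmin_pos; lra).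
  exists (mkposreal _ He); simpl; intros h Hh Hlt.
  pose proof (Rmin_l d (Rmin x (1 - x))); pose proof (Rmin_r d (Rmin x (1 - x))).
  pose proof (Rmin_l x (1 - x)); pose proof (Rmin_r x (1 - x)).
  apply Hb; [assumption | lra |].
  unfold in01; unfold Rabs in Hlt; destruct Rcase_abs in Hlt; lra.
Qed.

Lemma is_derive_has_deriv01R f l x : is_derive f x l -> has_deriv01R f l x.
Proof.
  intros H eps Heps; apply is_derive_Reals in H.
  destruct (H eps Heps) as [d Hd].
  exists d; split; [apply cond_pos|]; intros h Hh Hlt _; apply Hd; assumption.
Qed.

Lemma integral01_I01 g : cont01 g -> integral01 g (I01 g).
Proof.
  intros Hg; exists (fun t => RInt (fun s => g (clamp s)) 0 t); split.
  - intros x Hx; rewrite <- (clamp_id x Hx) at 1.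
    apply is_derive_has_deriv01R, I01_primitive; assumption.
  - rewrite RInt_point; unfold zero; simpl; rewrite Rminus_0_r.
    apply RInt_ext; rewrite Rmin_left, Rmax_right by lra; intros x Hx.
    rewrite clamp_id; [reflexivity | unfold in01; lra].
Qed.

Lemma integral01_unique g l : cont01 g -> integral01 g l -> l = I01 g.
Proof.
  intros Hg [F [HF ->]]; symmetry; apply I01_derive; [|assumption|].
  - apply has_deriv01R_cont01 with (1 := HF).
  - intros x Hx; apply has_deriv01R_is_derive; [assumption|].
    apply HF; unfold in01; lra.
Qed.

(** Identities obtained by differentiation hold at first only at interior points; this extends them
    to the ends. A nonzero difference would persist near [x], and every neighbourhood of [x] in the
    closed interval meets the open one. *)
Lemma cont01_eq_closed f g : cont01 f -> cont01 g ->
  (forall x, 0 < x < 1 -> f x = g x) -> forall x, in01 x -> f x = g x.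
Proof.
  intros Hf Hg E.
  assert (K : forall x, in01 x -> ~ f x <> g x).
  { intros x Hx Hne.
    set (d := fun t => f t - g t).
    assert (Hd : cont01 d) by (apply cont01_minus; assumption).
    assert (Hpos : 0 < Rabs (d x)) by (apply Rabs_pos_lt; unfold d; lra).
    specialize (Hd x); apply filterlim_locally with (eps := mkposreal _ Hpos) in Hd.
    destruct Hd as [e He]; pose proof (cond_pos e) as Hep.
    set (r := Rmin (e / 2) (1 / 2)).
    assert (Hr : 0 < r) by (apply Rmin_pos; lra).
    pose proof (Rmin_l (e / 2) (1 / 2)); pose proof (Rmin_r (e / 2) (1 / 2)); fold r in H, H0.
    destruct Hx as [Hx0 Hx1].
    assert (exists y, 0 < y < 1 /\ Rabs (y - x) < e) as [y [Hy Hye]].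
    { destruct (Rle_dec x (1 / 2)).
      - exists (x + r / 2); split; [lra|].
        replace (x + r / 2 - x) with (r / 2) by ring; rewrite Rabs_pos_eq; lra.
      - exists (x - r / 2); split; [lra|].
        replace (x - r / 2 - x) with (- (r / 2)) by ring.
        rewrite Rabs_Ropp, Rabs_pos_eq; lra. }
    specialize (He y Hye).
    change (Rabs (d (clamp y) - d (clamp x)) < Rabs (d x)) in He.
    rewrite !clamp_id in He by (unfold in01; lra).
    unfold d in He; rewrite (E y Hy) in He.
    replace (g y - g y - (f x - g x)) with (- (f x - g x)) in He by ring.
    rewrite Rabs_Ropp in He; lra. }
  intros x Hx; destruct (Req_dec (f x) (g x)); [assumption|].
  exfalso; apply (K x Hx); assumption.
Qed.

(** * Absorption *)

Lemma exists_nat_large (n1 : nat) (A : R) : exists n, (n1 <= n)%nat /\ A <= INR n.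
Proof.
  destruct (INR_unbounded A) as [k Hk].
  exists (Nat.max n1 k); split; [lia|].
  apply Rle_trans with (INR k); [lra|]; apply le_INR; lia.
Qed.

(* The telescoping potential [Phi] contributes only its two ends, the one at infinity
   vanishes, and the error terms carry a factor [K / n] which for [n >= n0] is small
   compared with [c].  The bound depends on [c], [K], [rho] only. *)
Lemma absorption (c K rho : R) (n1 : nat) :
  0 < c -> 0 <= K -> 0 <= rho < 1 ->
  exists n0 A, (n1 <= n0)%nat /\ 0 <= A /\
  forall Z H Phi : nat -> R,
    (forall n, 0 <= Z n) -> (forall n, 0 <= H n) ->
    (forall n, Rabs (Phi n) <= K * (Z n + Z (S n))) ->
    (forall n, (n1 <= n)%nat ->
       c * Z (S n) <= Phi n - Phi (S n)
         + K / (INR n + 1) * (Z n + Z (S n) + Z (S (S n)) + H (S n))) ->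
    (forall n, H (S n) <= rho * H n + K * Z n) ->
    (forall eps, 0 < eps -> exists M0, forall M, (M0 <= M)%nat -> Z M < eps) ->
    forall M, sum_f_R0 (fun i => Z (S (n0 + i))) M <= A * (Z n0 + Z (S n0) + H n0).
Proof.
  intros Hc HK Hr.
  (* [L] counts how often the sum of [Z] occurs among the errors: three shifted copies, and the
     forcing, whose sum is bounded through its recursion by [K / (1 - rho)] times that of [Z], up to
     initial terms. From [n0] on, all this costs at most [c / 2]. *)
  set (L := 3 + K / (1 - rho)).
  assert (HKr : 0 <= K / (1 - rho)) by (apply Rdiv_le_0_compat; lra).
  assert (Hir : 0 < / (1 - rho)) by (apply Rinv_0_lt_compat; lra).
  assert (HL : 0 < L) by (unfold L; lra).
  destruct (exists_nat_large n1 (2 * K * L / c)) as [n0 [Hn0 HA]].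
  set (e := K / (INR n0 + 1)).
  assert (Hpos : 0 < INR n0 + 1) by (pose proof (pos_INR n0); lra).
  assert (He0 : 0 <= e) by (apply Rdiv_le_0_compat; lra).
  assert (HeL : e * L <= c / 2).
  { unfold e.
    apply Rmult_le_reg_r with (2 * (INR n0 + 1) / c).
    { apply Rdiv_lt_0_compat; lra. }
    replace (K / (INR n0 + 1) * L * (2 * (INR n0 + 1) / c)) with (2 * K * L / c)
      by (field; lra).
    replace (c / 2 * (2 * (INR n0 + 1) / c)) with (INR n0 + 1) by (field; lra).
    lra. }
  exists n0, (2 / c * (K + e * (1 + (1 + K) * / (1 - rho)))).
  split; [assumption|].
  assert (HB0 : 0 <= e * (1 + (1 + K) * / (1 - rho))).
  { apply Rmult_le_pos; [assumption|].
    assert (0 <= (1 + K) * / (1 - rho)) by (apply Rmult_le_pos; lra). lra. }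
  assert (H2c : 0 < 2 / c) by (apply Rdiv_lt_0_compat; lra).
  split; [apply Rmult_le_pos; lra|].
  intros Z H Phi HZ HH HPhi Hmain HHr Hlim.
  set (SZ := fun M => sum_f_R0 (fun i => Z (S (n0 + i))) M).
  set (SH := fun M => sum_f_R0 (fun i => H (S (n0 + i))) M).
  assert (HE : forall n, (n0 <= n)%nat ->
     c * Z (S n) <= Phi n - Phi (S n) + e * (Z n + Z (S n) + Z (S (S n)) + H (S n))).
  { intros n Hn; eapply Rle_trans; [apply Hmain; lia|].
    apply Rplus_le_compat_l, Rmult_le_compat_r.
    - pose proof (HZ n); pose proof (HZ (S n)); pose proof (HZ (S (S n)));
        pose proof (HH (S n)); lra.
    - unfold e, Rdiv; apply Rmult_le_compat_l; [assumption|].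
      apply Rinv_le_contravar; [assumption|].
      apply Rplus_le_compat_r, le_INR; assumption. }
  assert (I1 : forall M, c * SZ M <= Phi n0 - Phi (S (n0 + M))
     + e * (Z n0 + 3 * SZ M + Z (S (S (n0 + M))) - Z (S (n0 + M)) - Z (S n0) + SH M)).
  { induction M as [|M IH].
    - unfold SZ, SH; simpl; rewrite Nat.add_0_r.
      pose proof (HE n0 (Nat.le_refl _)).
      assert (0 <= e * Z (S n0)) by (apply Rmult_le_pos; auto). nra.
    - unfold SZ, SH; rewrite !tech5; fold (SZ M) (SH M).
      replace (n0 + S M)%nat with (S (n0 + M)) by lia.
      pose proof (HE (S (n0 + M)) ltac:(lia)). nra. }
  assert (I2 : forall M, SH M <= rho * (H n0 + SH M) + K * (Z n0 + SZ M)
                           - rho * H (S (n0 + M)) - K * Z (S (n0 + M))).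
  { induction M as [|M IH].
    - unfold SZ, SH; simpl; rewrite Nat.add_0_r.
      pose proof (HHr n0). nra.
    - unfold SZ, SH; rewrite !tech5; fold (SZ M) (SH M).
      replace (n0 + S M)%nat with (S (n0 + M)) by lia.
      pose proof (HHr (S (n0 + M))). nra. }
  assert (I3 : forall M, SH M <= / (1 - rho) * (H n0 + K * Z n0) + K / (1 - rho) * SZ M).
  { intros M.
    apply Rmult_le_reg_l with (1 - rho); [lra|].
    replace ((1 - rho) * (/ (1 - rho) * (H n0 + K * Z n0) + K / (1 - rho) * SZ M))
      with (H n0 + K * Z n0 + K * SZ M) by (field; lra).
    pose proof (I2 M).
    assert (0 <= rho * H (S (n0 + M))) by (apply Rmult_le_pos; [lra|auto]).
    assert (0 <= K * Z (S (n0 + M))) by (apply Rmult_le_pos; auto).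
    assert (rho * H n0 <= H n0) by (pose proof (HH n0); nra).
    lra. }
  assert (SZ0 : forall M, 0 <= SZ M) by (intros; apply cond_pos_sum; auto).
  set (D := Z n0 + Z (S n0) + H n0).
  set (B := K + e * (1 + (1 + K) * / (1 - rho))).
  assert (I4 : forall M, c / 2 * SZ M <=
       B * D + (K + e) * (Z (S (n0 + M)) + Z (S (S (n0 + M))))).
  { intros M.
    pose proof (I1 M) as J1.
    pose proof (Rmult_le_compat_l e _ _ He0 (I3 M)) as J3.
    pose proof (Rmult_le_compat_r (SZ M) _ _ (SZ0 M) HeL) as J5.
    replace (e * L * SZ M) with (e * (3 * SZ M) + e * (K / (1 - rho) * SZ M)) in J5
      by (unfold L; ring).
    pose proof (HPhi n0) as P0; pose proof (HPhi (S (n0 + M))) as P1.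
    pose proof (Rle_abs (Phi n0)) as A0.
    pose proof (Rle_abs (- Phi (S (n0 + M)))) as A1; rewrite Rabs_Ropp in A1.
    assert (E1 : / (1 - rho) * (H n0 + K * Z n0) <= (1 + K) * / (1 - rho) * D).
    { rewrite (Rmult_comm (1 + K)), Rmult_assoc.
      apply Rmult_le_compat_l; [lra|]; unfold D.
      pose proof (HZ n0); pose proof (HZ (S n0)); pose proof (HH n0).
      assert (0 <= K * (Z (S n0) + H n0)) by (apply Rmult_le_pos; lra).
      lra. }
    pose proof (Rmult_le_compat_l e _ _ He0 E1) as J6.
    assert (E2 : e * Z n0 <= e * D).
    { apply Rmult_le_compat_l; [assumption|]; unfold D.
      pose proof (HZ (S n0)); pose proof (HH n0); lra. }
    assert (E3 : K * (Z n0 + Z (S n0)) <= K * D).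
    { apply Rmult_le_compat_l; [assumption|]; unfold D; pose proof (HH n0); lra. }
    assert (0 <= e * Z (S n0)) by (apply Rmult_le_pos; auto).
    assert (0 <= e * Z (S (n0 + M))) by (apply Rmult_le_pos; auto).
    unfold B. lra. }
  assert (mono : forall M N, (M <= N)%nat -> SZ M <= SZ N).
  { intros M N HMN; induction HMN as [|N _ IH]; [lra|].
    change (SZ (S N)) with (SZ N + Z (S (n0 + S N))); pose proof (HZ (S (n0 + S N))); lra. }
  intros M; fold (SZ M); fold D; fold B.
  (* The potential at the far end is removed by summing up to [M + M0], where [Z] is already below
     [d], and by monotonicity of [SZ]. *)
  apply le_epsilon; intros eps Heps.
  set (d := eps * (c / 2) / (2 * (K + e) + 1)).
  assert (Hd : 0 < d).
  { apply Rdiv_lt_0_compat; [apply Rmult_lt_0_compat; lra | lra]. }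
  destruct (Hlim d Hd) as [M0 HM0].
  pose proof (mono M (M + M0)%nat ltac:(lia)) as Hm.
  pose proof (I4 (M + M0)%nat) as J.
  pose proof (HM0 (S (n0 + (M + M0))) ltac:(lia)).
  pose proof (HM0 (S (S (n0 + (M + M0)))) ltac:(lia)).
  assert (F : (K + e) * (Z (S (n0 + (M + M0))) + Z (S (S (n0 + (M + M0))))) <= eps * (c / 2)).
  { apply Rle_trans with ((K + e) * (2 * d)).
    - apply Rmult_le_compat_l; lra.
    - unfold d.
      apply Rmult_le_reg_r with (2 * (K + e) + 1); [lra|].
      replace ((K + e) * (2 * (eps * (c / 2) / (2 * (K + e) + 1))) * (2 * (K + e) + 1))
        with (2 * (K + e) * (eps * (c / 2))) by (field; lra).
      assert (0 < eps * (c / 2)) by (apply Rmult_lt_0_compat; lra). nra. }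
  apply Rmult_le_reg_l with (c / 2); [lra|].
  replace (c / 2 * (2 / c * B * D + eps)) with (B * D + eps * (c / 2)) by (field; lra).
  apply Rle_trans with (c / 2 * SZ (M + M0)%nat); [apply Rmult_le_compat_l; lra | lra].
Qed.

(** * Pointwise energy inequalities *)

(* Here [(p0, q0)], [(p1, q1)], [(p2, q2)] are the real and imaginary
   parts of three consecutive normalised derivatives, [t], [T] the corresponding radii,
   [m - 1] is the order of the middle one and [m * x] the natural scale near [x = 0]. *)

(* [(Re, Im)] of [x^2 w' + (2 m x + s) w + t w0], where [w' = m (m+1) / T * w2]. *)
Definition eqre (sr si m x t T p0 p1 q1 p2 : R) : R :=
  x ^ 2 * (m * (m + 1) / T * p2) + (2 * (m * x) + sr) * p1 - si * q1 + t * p0.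
Definition eqim (sr si m x t T q0 p1 q1 q2 : R) : R :=
  x ^ 2 * (m * (m + 1) / T * q2) + (2 * (m * x) + sr) * q1 + si * p1 + t * q0.

(** The derivative of [p^2 + q^2] when [p] and [q] have derivatives [l p'] and [l q']. *)
Definition dnorm (l p q p' q' : R) : R := 2 * l * (p * p' + q * q').

(** Its derivative produces, in this order of terms, [y x^2 Re (w1' conj w1)],
    [t y Re (w0 conj w1)], [b y Re (w1 conj w2)] and [- t y Im (w2 conj w0)]. In the last one the
    derivative of [w0] drops out, being parallel to [w1]. Every term contains a factor [x], so
    nothing is left at [x = 0]. *)
Definition flux (b m x t T p0 q0 p1 q1 : R) : R :=
  m * x ^ 3 / 2 * (p1 ^ 2 + q1 ^ 2)
  + x * (t ^ 2 / (2 * (m - 1))) * (p0 ^ 2 + q0 ^ 2)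
  + x * (b * T / (2 * (m + 1))) * (p1 ^ 2 + q1 ^ 2)
  - x * (t * T / (m + 1)) * (q1 * p0 - p1 * q0).

Definition dflux (b m x t T p0 q0 p1 q1 p2 q2 : R) : R :=
  3 * m * x ^ 2 / 2 * (p1 ^ 2 + q1 ^ 2)
  + m * x ^ 3 / 2 * dnorm (m * (m + 1) / T) p1 q1 p2 q2
  + t ^ 2 / (2 * (m - 1)) * (p0 ^ 2 + q0 ^ 2)
  + x * (t ^ 2 / (2 * (m - 1))) * dnorm ((m - 1) * m / t) p0 q0 p1 q1
  + b * T / (2 * (m + 1)) * (p1 ^ 2 + q1 ^ 2)
  + x * (b * T / (2 * (m + 1))) * dnorm (m * (m + 1) / T) p1 q1 p2 q2
  - t * T / (m + 1) * (q1 * p0 - p1 * q0)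
  - x * (t * T / (m + 1)) * (m * (m + 1) / T * (q2 * p0 - p2 * q0)).

Definition potential (c a b t T y p0 q0 p1 q1 : R) : R :=
  2 * T * t * (q1 * p0 - p1 * q0)
  - ((2 * T * b - a * y + 2 * y ^ 2) / 2 - c * (1 + y ^ 2)) * (p1 ^ 2 + q1 ^ 2).

(* The multiplier is [2 T Im(. conj w1) + y Re(. conj w1) + y Im(. conj w2)]: the terms
   [y^2 Im(w2 conj w1)] produced by its first and third parts cancel to leading order, and
   products [Re(w1 conj w2)], [Im(w0 conj w2)] are exact derivatives up to factors [1/m]. *)
Lemma energy_identity a b m x t T p0 q0 p1 q1 p2 q2 :
  1 < m -> 0 < t -> 0 < T ->
  let gp := eqre (- a) b m x t T p0 p1 q1 p2 in
  let gq := eqim (- a) b m x t T q0 p1 q1 q2 in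
  let y := m * x in
  2 * T * (gq * p1 - gp * q1) + y * (gp * p1 + gq * q1) + y * (gq * p2 - gp * q2) =
  dflux b m x t T p0 q0 p1 q1 p2 q2
  + (2 * T * b - a * y + 2 * y ^ 2) * (p1 ^ 2 + q1 ^ 2)
  + a * y * (q2 * p1 - p2 * q1) - 2 * T * t * (q1 * p0 - p1 * q0)
  + 2 / m * y ^ 2 * (q2 * p1 - p2 * q1)
  - 3 / 2 * (y ^ 2 / m) * (p1 ^ 2 + q1 ^ 2)
  - t ^ 2 / (2 * (m - 1)) * (p0 ^ 2 + q0 ^ 2)
  - b * T / (2 * (m + 1)) * (p1 ^ 2 + q1 ^ 2)
  + t * T / (m + 1) * (q1 * p0 - p1 * q0).
Proof.
  intros Hm Ht HT; cbv zeta; unfold eqre, eqim, dflux, dnorm; field; lra.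
Qed.

Lemma sumsq_ge0 x y : 0 <= x ^ 2 + y ^ 2.
Proof. pose proof (pow2_ge_0 x); pose proof (pow2_ge_0 y); lra. Qed.

Lemma cross_bound p q p' q' :
  Rabs (q' * p - p' * q) <= ((p ^ 2 + q ^ 2) + (p' ^ 2 + q' ^ 2)) / 2.
Proof.
  apply Rabs_le; split;
    pose proof (pow2_ge_0 (q' + p)); pose proof (pow2_ge_0 (q' - p));
    pose proof (pow2_ge_0 (p' + q)); pose proof (pow2_ge_0 (p' - q)); nra.
Qed.

(** The weight [m] is adapted to a residual [g] of size [1 / m]: both halves are then [O(1/m)]. *)
Lemma young m g r : 0 < m -> g * r <= (m * g ^ 2 + r ^ 2 / m) / 2.
Proof.
  intros Hm.
  assert (E : (m * g ^ 2 + r ^ 2 / m) / 2 - g * r = (m * g - r) ^ 2 / (2 * m))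
    by (field; lra).
  assert (0 <= (m * g - r) ^ 2 / (2 * m))
    by (apply Rdiv_le_0_compat; [apply pow2_ge_0 | lra]).
  lra.
Qed.

Lemma mult_Rabs_bound r z u v : Rabs r <= u -> Rabs z <= v -> r * z <= u * v.
Proof.
  intros H1 H2; apply Rle_trans with (Rabs (r * z)); [apply Rle_abs|].
  rewrite Rabs_mult; apply Rmult_le_compat; auto using Rabs_pos.
Qed.

(** The identity offers [2 Q |w1|^2 + 2 c (1 + y^2) |w1|^2], with [Q] as set below. Telescoping
    [2 T t Im (w1 conj w0)] merges the cross terms into [(a y - 2 T^2) Im (w2 conj w1)], which the
    last hypothesis bounds by [Q (|w1|^2 + |w2|^2)]. The part falling on [w2] is paid by the next
    order, through the second term of [potential]. All remaining terms are [O(1/m)]. *)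
Lemma energy_pointwise a b c S kap K0 m x t T T2 p0 q0 p1 q1 p2 q2 h2 :
  2 <= m -> 0 <= x -> 0 < t <= S -> 0 < T <= S -> 0 < T2 <= S ->
  0 <= a -> 0 < b -> 0 < c <= 1 -> 0 <= kap -> 0 <= K0 -> 0 <= h2 ->
  Rabs (T2 - T) <= kap / m ->
  let gp := eqre (- a) b m x t T p0 p1 q1 p2 in
  let gq := eqim (- a) b m x t T q0 p1 q1 q2 in
  let y := m * x in
  gp ^ 2 + gq ^ 2 <= K0 / m ^ 2 * h2 ->
  Rabs (a * y - 2 * T ^ 2) <= 2 * T * b - a * y + 2 * y ^ 2 - 2 * c * (1 + y ^ 2) ->
  2 * c * (1 + y ^ 2) * (p1 ^ 2 + q1 ^ 2) + dflux b m x t T p0 q0 p1 q1 p2 q2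
  <= potential c a b t T y p0 q0 p1 q1
     - potential c a b T T2 ((m + 1) * x) p1 q1 p2 q2
     + ((S + 1) * K0 + S + kap * b + a + S * kap + 3 + 2 * S ^ 2 + b * S) / m
       * ((1 + y ^ 2) * ((p1 ^ 2 + q1 ^ 2) + (p2 ^ 2 + q2 ^ 2)) + (p0 ^ 2 + q0 ^ 2) + h2).
Proof.
  intros Hm Hx Ht HT HT2 Ha Hb Hc Hkap HK0 Hh2 Hdiff gp gq y Hg HR.
  pose proof (energy_identity a b m x t T p0 q0 p1 q1 p2 q2 ltac:(lra) (proj1 Ht) (proj1 HT)) as E.
  cbv zeta in E; fold gp gq y in E.
  set (dF := dflux b m x t T p0 q0 p1 q1 p2 q2) in *.
  set (J1 := q1 * p0 - p1 * q0) in *.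
  set (J2 := q2 * p1 - p2 * q1) in *.
  pose proof (cross_bound p0 q0 p1 q1) as HJ1; fold J1 in HJ1.
  pose proof (cross_bound p1 q1 p2 q2) as HJ2; fold J2 in HJ2.
  set (A0 := p0 ^ 2 + q0 ^ 2) in *.
  set (A1 := p1 ^ 2 + q1 ^ 2) in *.
  set (A2 := p2 ^ 2 + q2 ^ 2) in *.
  assert (HA0 : 0 <= A0) by apply sumsq_ge0.
  assert (HA1 : 0 <= A1) by apply sumsq_ge0.
  assert (HA2 : 0 <= A2) by apply sumsq_ge0.
  assert (Hy : 0 <= y) by (unfold y; nra).
  set (i := / m).
  assert (Hi : 0 < i) by (apply Rinv_0_lt_compat; lra).
  set (g2 := gp ^ 2 + gq ^ 2) in *.
  assert (Hmg : m * g2 <= i * (K0 * h2)).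
  { apply Rle_trans with (m * (K0 / m ^ 2 * h2)).
    - apply Rmult_le_compat_l; lra.
    - unfold i; right; field; lra. }
  assert (B1 : 2 * (gq * p1 - gp * q1) <= m * g2 + i * A1).
  { pose proof (young m gq p1 ltac:(lra)); pose proof (young m (- gp) q1 ltac:(lra)).
    unfold g2, A1, i, Rdiv in *; nra. }
  assert (B2 : y * (gp * p1 + gq * q1) <= (m * g2 + i * (y ^ 2 * A1)) / 2).
  { pose proof (young m gp (y * p1) ltac:(lra)); pose proof (young m gq (y * q1) ltac:(lra)).
    unfold g2, A1, i, Rdiv in *; nra. }
  assert (B3 : y * (gq * p2 - gp * q2) <= (m * g2 + i * (y ^ 2 * A2)) / 2).
  { pose proof (young m gq (y * p2) ltac:(lra)); pose proof (young m (- gp) (y * q2) ltac:(lra)).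
    unfold g2, A2, i, Rdiv in *; nra. }
  assert (B4 : 2 * T * (gq * p1 - gp * q1) <= S * (i * (K0 * h2) + i * A1)).
  { apply Rle_trans with (T * (m * g2 + i * A1)).
    - replace (2 * T * (gq * p1 - gp * q1)) with (T * (2 * (gq * p1 - gp * q1))) by ring.
      apply Rmult_le_compat_l; lra.
    - apply Rmult_le_compat; try lra.
      assert (0 <= g2) by apply sumsq_ge0.
      assert (0 <= i * A1) by (apply Rmult_le_pos; lra). nra. }
  assert (Hmi : kap / m = kap * i) by reflexivity.
  assert (E1 : 2 * T * (T2 - T) * J2 <= S * (kap * i) * (A1 + A2)).
  { replace (S * (kap * i) * (A1 + A2)) with ((2 * S * (kap * i)) * ((A1 + A2) / 2)) by field.
    apply mult_Rabs_bound; [|assumption].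
    rewrite Rabs_mult, (Rabs_pos_eq (2 * T)) by lra.
    apply Rmult_le_compat; try lra; apply Rabs_pos. }
  assert (E2 : - (2 / m * y ^ 2 * J2) <= i * (y ^ 2 * (A1 + A2))).
  { replace (- (2 / m * y ^ 2 * J2)) with ((- (2 * i * y ^ 2)) * J2) by (unfold i; field; lra).
    replace (i * (y ^ 2 * (A1 + A2))) with ((2 * i * y ^ 2) * ((A1 + A2) / 2)) by field.
    apply mult_Rabs_bound; [|assumption].
    rewrite Rabs_Ropp, Rabs_pos_eq; [lra|].
    apply Rmult_le_pos; [lra | apply pow2_ge_0]. }
  assert (E3 : t ^ 2 / (2 * (m - 1)) * A0 <= i * (S ^ 2 * A0)).
  { rewrite <- Rmult_assoc; apply Rmult_le_compat_r; [assumption|].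
    unfold Rdiv; rewrite Rmult_comm; apply Rmult_le_compat.
    - left; apply Rinv_0_lt_compat; lra.
    - apply pow2_ge_0.
    - unfold i; apply Rinv_le_contravar; lra.
    - apply pow_incr; lra. }
  assert (Hi1 : / (m + 1) <= i) by (unfold i; apply Rinv_le_contravar; lra).
  assert (Hi1' : 0 < / (m + 1)) by (apply Rinv_0_lt_compat; lra).
  assert (E4 : b * T / (2 * (m + 1)) * A1 <= i * (b * S * A1)).
  { replace (b * T / (2 * (m + 1)) * A1) with (/ (m + 1) * (b * (T / 2) * A1)) by (field; lra).
    apply Rmult_le_compat; try lra.
    - repeat apply Rmult_le_pos; lra.
    - apply Rmult_le_compat_r; [assumption|]; apply Rmult_le_compat_l; lra. }
  assert (E5 : - (t * T / (m + 1) * J1) <= i * (S ^ 2 * ((A0 + A1) / 2))).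
  { replace (- (t * T / (m + 1) * J1)) with ((- (/ (m + 1) * (t * T))) * J1) by (field; lra).
    replace (i * (S ^ 2 * ((A0 + A1) / 2))) with ((i * S ^ 2) * ((A0 + A1) / 2)) by ring.
    apply mult_Rabs_bound; [|assumption].
    assert (0 <= t * T) by (apply Rmult_le_pos; lra).
    rewrite Rabs_Ropp, Rabs_pos_eq by (apply Rmult_le_pos; lra).
    apply Rmult_le_compat; try lra.
    simpl; rewrite Rmult_1_r; apply Rmult_le_compat; lra. }
  set (Q := (2 * T * b - a * y + 2 * y ^ 2) / 2 - c * (1 + y ^ 2)).
  set (y' := (m + 1) * x).
  set (Q' := (2 * T2 * b - a * y' + 2 * y' ^ 2) / 2 - c * (1 + y' ^ 2)).
  assert (Hyy : y' = y + y * i) by (unfold y', y, i; field; lra).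
  assert (Hyi : 0 <= y * i) by (apply Rmult_le_pos; lra).
  (* Only an upper bound is needed: the growth of [y^2] towards [y'^2] has the good sign, while the
     changes of [T b] and [a y] are [O(1/m)] relative to [1 + y^2]. *)
  assert (E6 : (Q - Q') * A2 <= i * ((kap * b + a) * ((1 + y ^ 2) * A2))).
  { replace (i * ((kap * b + a) * ((1 + y ^ 2) * A2)))
      with (i * ((kap * b + a) * (1 + y ^ 2)) * A2) by ring.
    apply Rmult_le_compat_r; [assumption|].
    assert (F1 : (T - T2) * b <= kap * i * b).
    { apply Rmult_le_compat_r; [lra|].
      pose proof (Rle_abs (- (T2 - T))) as F; rewrite Rabs_Ropp in F; lra. }
    assert (F2 : 0 <= (1 - c) * (y' ^ 2 - y ^ 2)).
    { apply Rmult_le_pos; [lra|]; rewrite Hyy.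
      assert (0 <= y * (y * i)) by (apply Rmult_le_pos; assumption). nra. }
    assert (F3 : a * (y' - y) / 2 <= i * (a * (1 + y ^ 2))).
    { rewrite Hyy.
      replace (a * (y + y * i - y) / 2) with (i * (a * (y / 2))) by field.
      apply Rmult_le_compat_l; [lra|]; apply Rmult_le_compat_l; [lra|].
      pose proof (pow2_ge_0 (y - 1)); nra. }
    assert (F4 : kap * i * b <= i * (kap * b * (1 + y ^ 2))).
    { replace (kap * i * b) with (i * (kap * b * 1)) by ring.
      apply Rmult_le_compat_l; [lra|]; apply Rmult_le_compat_l.
      - apply Rmult_le_pos; lra.
      - pose proof (pow2_ge_0 y); lra. }
    unfold Q, Q'; lra. }
  assert (E7 : - ((a * y - 2 * T ^ 2) * J2) <= Q * (A1 + A2)).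
  { replace (Q * (A1 + A2)) with ((2 * Q) * ((A1 + A2) / 2)) by field.
    replace (- ((a * y - 2 * T ^ 2) * J2)) with ((- (a * y - 2 * T ^ 2)) * J2) by ring.
    apply mult_Rabs_bound; [|assumption].
    rewrite Rabs_Ropp; unfold Q; lra. }
  unfold potential; fold J1 J2 A0 A1 A2 Q.
  fold y'; fold Q'.
  set (G := (1 + y ^ 2) * (A1 + A2) + A0 + h2).
  set (K := (S + 1) * K0 + S + kap * b + a + S * kap + 3 + 2 * S ^ 2 + b * S).
  assert (Hy2 : 0 <= y ^ 2) by apply pow2_ge_0.
  assert (Hy1 : 0 <= y ^ 2 * A1) by (apply Rmult_le_pos; assumption).
  assert (Hy2' : 0 <= y ^ 2 * A2) by (apply Rmult_le_pos; assumption).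
  assert (G1 : 0 <= A1 + y ^ 2 * A1 <= G) by (unfold G; split; nra).
  assert (G2 : 0 <= A2 + y ^ 2 * A2 <= G) by (unfold G; split; nra).
  assert (G12 : A1 + A2 + y ^ 2 * (A1 + A2) <= G) by (unfold G; nra).
  assert (G0 : A0 + A1 <= G) by (unfold G; nra).
  assert (Gh : 0 <= h2 <= G) by (unfold G; split; nra).
  assert (Fin : K / m * G = i * (K * G)) by (unfold i; field; lra).
  rewrite Fin.
  assert (Sum : (S + 1) * (K0 * h2) + S * A1 + y ^ 2 * (A1 + A2) / 2
     + S * kap * (A1 + A2) + y ^ 2 * (A1 + A2) + 3 / 2 * (y ^ 2 * A1) + S ^ 2 * A0
     + b * S * A1 + S ^ 2 * ((A0 + A1) / 2) + (kap * b + a) * ((1 + y ^ 2) * A2) <= K * G).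
  { assert (P1 : (S + 1) * (K0 * h2) <= (S + 1) * K0 * G).
    { rewrite <- Rmult_assoc; apply Rmult_le_compat_l; [apply Rmult_le_pos|]; lra. }
    assert (P2 : S * A1 <= S * G) by (apply Rmult_le_compat_l; lra).
    assert (P3 : S * kap * (A1 + A2) <= S * kap * G)
      by (apply Rmult_le_compat_l; [apply Rmult_le_pos; lra | nra]).
    assert (P4 : S ^ 2 * A0 <= S ^ 2 * G) by (apply Rmult_le_compat_l; [apply pow2_ge_0|lra]).
    assert (P5 : b * S * A1 <= b * S * G)
      by (apply Rmult_le_compat_l; [apply Rmult_le_pos; lra | lra]).
    assert (P6 : S ^ 2 * ((A0 + A1) / 2) <= S ^ 2 * G)
      by (apply Rmult_le_compat_l; [apply pow2_ge_0|lra]).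
    assert (P7 : (kap * b + a) * ((1 + y ^ 2) * A2) <= (kap * b + a) * G).
    { apply Rmult_le_compat_l; [|lra].
      assert (0 <= kap * b) by (apply Rmult_le_pos; lra); lra. }
    unfold K; lra. }
  apply (Rmult_le_compat_l i) in Sum; [|lra].
  assert (E8 : 3 / 2 * (y ^ 2 / m) * A1 = i * (3 / 2 * (y ^ 2 * A1))) by (unfold i; field; lra).
  assert (Split : dF = 2 * T * (gq * p1 - gp * q1) + y * (gp * p1 + gq * q1)
    + y * (gq * p2 - gp * q2) - ((2 * T * b - a * y + 2 * y ^ 2) * A1)
    - a * y * J2 + 2 * T * t * J1 - 2 / m * y ^ 2 * J2 + 3 / 2 * (y ^ 2 / m) * A1
    + t ^ 2 / (2 * (m - 1)) * A0 + b * T / (2 * (m + 1)) * A1 - t * T / (m + 1) * J1) by lra.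
  rewrite Split, E8.
  assert (QA : (2 * T * b - a * y + 2 * y ^ 2) * A1 = 2 * Q * A1 + 2 * c * (1 + y ^ 2) * A1)
    by (unfold Q; field).
  rewrite QA.
  clear - B2 B3 B4 E1 E2 E3 E4 E5 E6 E7 Sum Hmg.
  lra.
Qed.

Lemma flux_nonneg b m t T p0 q0 p1 q1 :
  2 <= m -> 0 < t -> 0 < T <= m -> 0 < b -> 0 <= flux b m 1 t T p0 q0 p1 q1.
Proof.
  intros Hm Ht HT Hb; unfold flux.
  pose proof (cross_bound (t / m * p0) (t / m * q0) p1 q1) as HJ.
  set (A0 := p0 ^ 2 + q0 ^ 2).
  set (A1 := p1 ^ 2 + q1 ^ 2).
  assert (HA0 : 0 <= A0) by apply sumsq_ge0.
  assert (HA1 : 0 <= A1) by apply sumsq_ge0.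
  replace (q1 * (t / m * p0) - p1 * (t / m * q0)) with (t / m * (q1 * p0 - p1 * q0)) in HJ by ring.
  replace ((t / m * p0) ^ 2 + (t / m * q0) ^ 2) with ((t / m) ^ 2 * A0) in HJ
    by (unfold A0; ring).
  fold A1 in HJ.
  set (J := q1 * p0 - p1 * q0) in *.
  pose proof (Rle_abs (t / m * J)) as HJ'.
  assert (E1 : 1 * (t * T / (m + 1)) * J <= m * (((t / m) ^ 2 * A0 + A1) / 2)).
  { replace (1 * (t * T / (m + 1)) * J) with ((T * m / (m + 1)) * (t / m * J)) by (field; lra).
    assert (HTm : 0 <= T * m / (m + 1) <= m).
    { split.
      - apply Rdiv_le_0_compat; nra.
      - apply Rmult_le_reg_r with (m + 1); [lra|].
        replace (T * m / (m + 1) * (m + 1)) with (T * m) by (field; lra). nra. }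
    apply Rle_trans with ((T * m / (m + 1)) * (((t / m) ^ 2 * A0 + A1) / 2)).
    - apply Rmult_le_compat_l; lra.
    - apply Rmult_le_compat_r; [|lra].
      pose proof (pow2_ge_0 (t / m)).
      assert (0 <= (t / m) ^ 2 * A0) by (apply Rmult_le_pos; assumption). lra. }
  assert (E2 : m * ((t / m) ^ 2 * A0 / 2) <= 1 * (t ^ 2 / (2 * (m - 1))) * A0).
  { replace (m * ((t / m) ^ 2 * A0 / 2)) with (/ (2 * m) * (t ^ 2 * A0)) by (field; lra).
    replace (1 * (t ^ 2 / (2 * (m - 1))) * A0) with (/ (2 * (m - 1)) * (t ^ 2 * A0))
      by (field; lra).
    apply Rmult_le_compat_r; [apply Rmult_le_pos; [apply pow2_ge_0|assumption]|].
    apply Rinv_le_contravar; lra. }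
  assert (E3 : 0 <= 1 * (b * T / (2 * (m + 1))) * A1).
  { rewrite Rmult_1_l; apply Rmult_le_pos; [|assumption].
    apply Rdiv_le_0_compat; [apply Rmult_le_pos; lra | lra]. }
  lra.
Qed.

(* In the right half-plane the multiplier [(1 + y) Re(. conj w1)] is enough. *)
Definition flux_right (m x t p0 q0 p1 q1 : R) : R :=
  (x ^ 2 + m * x ^ 3) / 2 * (p1 ^ 2 + q1 ^ 2)
  + (1 + m * x) * (t ^ 2 / (2 * (m - 1) * m)) * (p0 ^ 2 + q0 ^ 2).

Definition dflux_right (m x t T p0 q0 p1 q1 p2 q2 : R) : R :=
  (x + 3 / 2 * (m * x ^ 2)) * (p1 ^ 2 + q1 ^ 2)
  + (x ^ 2 + m * x ^ 3) / 2 * dnorm (m * (m + 1) / T) p1 q1 p2 q2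
  + t ^ 2 / (2 * (m - 1)) * (p0 ^ 2 + q0 ^ 2)
  + (1 + m * x) * (t ^ 2 / (2 * (m - 1) * m)) * dnorm ((m - 1) * m / t) p0 q0 p1 q1.

Lemma energy_identity_right a b m x t T p0 q0 p1 q1 p2 q2 :
  1 < m -> 0 < t -> 0 < T ->
  let gp := eqre a b m x t T p0 p1 q1 p2 in
  let gq := eqim a b m x t T q0 p1 q1 q2 in
  let y := m * x in
  (1 + y) * (gp * p1 + gq * q1) =
  dflux_right m x t T p0 q0 p1 q1 p2 q2
  + (1 + y) * (2 * y + a) * (p1 ^ 2 + q1 ^ 2)
  - (y / m + 3 / 2 * (y ^ 2 / m)) * (p1 ^ 2 + q1 ^ 2)
  - t ^ 2 / (2 * (m - 1)) * (p0 ^ 2 + q0 ^ 2).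
Proof.
  intros Hm Ht HT; cbv zeta; unfold eqre, eqim, dflux_right, dnorm; field; lra.
Qed.

(** For [a > 0] the coefficient is coercive by itself, [(1 + y) (2 y + a) >= c (1 + y^2)], so
    neither cross terms nor a telescoping potential enter. *)
Lemma energy_pointwise_right a b c S K0 m x t T p0 q0 p1 q1 p2 q2 h2 :
  2 <= m -> 0 <= x -> 0 < t <= S -> 0 < T ->
  0 < c <= 2 -> c <= a -> 0 <= K0 -> 0 <= h2 ->
  let gp := eqre a b m x t T p0 p1 q1 p2 in
  let gq := eqim a b m x t T q0 p1 q1 q2 in
  let y := m * x in
  gp ^ 2 + gq ^ 2 <= K0 / m ^ 2 * h2 ->
  c * (1 + y ^ 2) * (p1 ^ 2 + q1 ^ 2) + dflux_right m x t T p0 q0 p1 q1 p2 q2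
  <= (K0 + 4 + S ^ 2) / m
       * ((1 + y ^ 2) * ((p1 ^ 2 + q1 ^ 2) + (p2 ^ 2 + q2 ^ 2)) + (p0 ^ 2 + q0 ^ 2) + h2).
Proof.
  intros Hm Hx Ht HT Hc Hca HK0 Hh2 gp gq y Hg.
  pose proof (energy_identity_right a b m x t T p0 q0 p1 q1 p2 q2
    ltac:(lra) (proj1 Ht) HT) as E.
  cbv zeta in E; fold gp gq y in E.
  set (dF := dflux_right m x t T p0 q0 p1 q1 p2 q2) in *.
  set (A0 := p0 ^ 2 + q0 ^ 2) in *.
  set (A1 := p1 ^ 2 + q1 ^ 2) in *.
  set (A2 := p2 ^ 2 + q2 ^ 2) in *.
  assert (HA0 : 0 <= A0) by apply sumsq_ge0.
  assert (HA1 : 0 <= A1) by apply sumsq_ge0.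
  assert (HA2 : 0 <= A2) by apply sumsq_ge0.
  assert (Hy : 0 <= y) by (unfold y; nra).
  assert (Hy2 : 0 <= y ^ 2) by apply pow2_ge_0.
  set (i := / m).
  assert (Hi : 0 < i) by (apply Rinv_0_lt_compat; lra).
  set (g2 := gp ^ 2 + gq ^ 2) in *.
  assert (Hmg : m * g2 <= i * (K0 * h2)).
  { apply Rle_trans with (m * (K0 / m ^ 2 * h2)).
    - apply Rmult_le_compat_l; lra.
    - unfold i; right; field; lra. }
  assert (B : (1 + y) * (gp * p1 + gq * q1) <= (m * g2 + i * ((1 + y) ^ 2 * A1)) / 2).
  { pose proof (young m gp ((1 + y) * p1) ltac:(lra));
      pose proof (young m gq ((1 + y) * q1) ltac:(lra)).
    unfold g2, A1, i, Rdiv in *; nra. }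
  assert (B' : (1 + y) ^ 2 * A1 <= 2 * (1 + y ^ 2) * A1).
  { apply Rmult_le_compat_r; [assumption|]; pose proof (pow2_ge_0 (1 - y)); nra. }
  apply (Rmult_le_compat_l i) in B'; [|lra].
  assert (E3 : t ^ 2 / (2 * (m - 1)) * A0 <= i * (S ^ 2 * A0)).
  { rewrite <- Rmult_assoc; apply Rmult_le_compat_r; [assumption|].
    unfold Rdiv; rewrite Rmult_comm; apply Rmult_le_compat.
    - left; apply Rinv_0_lt_compat; lra.
    - apply pow2_ge_0.
    - unfold i; apply Rinv_le_contravar; lra.
    - apply pow_incr; lra. }
  assert (E1 : (y / m + 3 / 2 * (y ^ 2 / m)) * A1 <= i * (2 * (1 + y ^ 2) * A1)).
  { replace ((y / m + 3 / 2 * (y ^ 2 / m)) * A1) with (i * ((y + 3 / 2 * y ^ 2) * A1))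
      by (unfold i; field; lra).
    apply Rmult_le_compat_l; [lra|]; apply Rmult_le_compat_r; [assumption|].
    pose proof (pow2_ge_0 (1 - y)); nra. }
  assert (E2 : c * (1 + y ^ 2) * A1 <= (1 + y) * (2 * y + a) * A1).
  { apply Rmult_le_compat_r; [assumption|]; nra. }
  set (G := (1 + y ^ 2) * (A1 + A2) + A0 + h2).
  assert (HyA2 : 0 <= (1 + y ^ 2) * A2) by (apply Rmult_le_pos; lra).
  assert (HyA1 : 0 <= (1 + y ^ 2) * A1) by (apply Rmult_le_pos; lra).
  assert (Sum : K0 * h2 + 4 * ((1 + y ^ 2) * A1) + S ^ 2 * A0 <= (K0 + 4 + S ^ 2) * G).
  { assert (K0 * h2 <= K0 * G) by (apply Rmult_le_compat_l; unfold G; lra).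
    assert (S ^ 2 * A0 <= S ^ 2 * G)
      by (apply Rmult_le_compat_l; [apply pow2_ge_0 | unfold G; lra]).
    assert ((1 + y ^ 2) * A1 <= G) by (unfold G; lra).
    lra. }
  apply (Rmult_le_compat_l i) in Sum; [|lra].
  replace ((K0 + 4 + S ^ 2) / m * G) with (i * ((K0 + 4 + S ^ 2) * G)) by (unfold i; field; lra).
  assert (0 <= i * (K0 * h2)) by (repeat apply Rmult_le_pos; lra).
  assert (0 <= i * ((1 + y ^ 2) * A1)) by (apply Rmult_le_pos; lra).
  lra.
Qed.

(** * Integrated energy inequalities *)

(* [p n + i q n] is the [n]-th normalised derivative; its derivative is a multiple of the
   next one, and three consecutive ones satisfy the differentiated equation up to a
   forcing of size [h2 / n^2]. *)
Record tower (sr si lo hi kap K0 K1 rho : R) (tau : nat -> R) (p q h2 : nat -> R -> R)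
  : Prop := {
  tower_tau : forall n, lo <= tau n <= hi;
  tower_tau_step : forall n, Rabs (tau (S (S n)) - tau (S n)) <= kap / (INR n + 1);
  tower_cont_re : forall n, cont01 (p n);
  tower_cont_im : forall n, cont01 (q n);
  tower_cont_h : forall n, cont01 (h2 n);
  tower_derive_re : forall n x, 0 < x < 1 ->
    is_derive (p n) x ((INR n + 1) * (INR n + 2) / tau (S n) * p (S n) x);
  tower_derive_im : forall n x, 0 < x < 1 ->
    is_derive (q n) x ((INR n + 1) * (INR n + 2) / tau (S n) * q (S n) x);
  tower_eq : forall n x, in01 x ->
    let m := INR n + 2 in
    eqre sr si m x (tau (S n)) (tau (S (S n))) (p n x) (p (S n) x) (q (S n) x) (p (S (S n)) x) ^ 2
    + eqim sr si m x (tau (S n)) (tau (S (S n))) (q n x) (p (S n) x) (q (S n) x) (q (S (S n)) x) ^ 2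
    <= K0 / m ^ 2 * h2 (S n) x;
  tower_h_ge0 : forall n x, in01 x -> 0 <= h2 n x;
  tower_h_step : forall n x, in01 x ->
    h2 (S n) x <= rho * h2 n x + K1 * (p n x ^ 2 + q n x ^ 2) }.

Definition bulk (p q : nat -> R -> R) (n : nat) : R :=
  I01 (fun x => (1 + ((INR n + 1) * x) ^ 2) * (p n x ^ 2 + q n x ^ 2)).
Definition trace0 (p q : nat -> R -> R) (n : nat) : R := p n 0 ^ 2 + q n 0 ^ 2.
Definition energy (p q : nat -> R -> R) (n : nat) : R := bulk p q n + trace0 p q n.
Definition forcing (h2 : nat -> R -> R) (n : nat) : R := I01 (h2 n) + h2 n 0.

(** The coerced part [Y] is kept apart from the full energy [Z] that measures the errors. Interior
    and boundary estimates can thus be proved separately, each with its own [Phi], and added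
    afterwards. *)
Definition dissipative (c K : R) (n1 : nat) (Y Z H : nat -> R) : Prop :=
  exists Phi : nat -> R,
    (forall n, Rabs (Phi n) <= K * (Z n + Z (S n))) /\
    forall n, (n1 <= n)%nat ->
      c * Y (S n) <= Phi n - Phi (S n)
        + K / (INR n + 1) * (Z n + Z (S n) + Z (S (S n)) + H (S n)).

Lemma dissipative_add c1 c2 K1 K2 n1 n2 Y1 Y2 Z H :
  (forall n, 0 <= Y1 n) -> (forall n, 0 <= Y2 n) ->
  dissipative c1 K1 n1 Y1 Z H -> dissipative c2 K2 n2 Y2 Z H ->
  dissipative (Rmin c1 c2) (K1 + K2) (Nat.max n1 n2) (fun n => Y1 n + Y2 n) Z H.
Proof.
  intros HY1 HY2 [P1 [B1 I1]] [P2 [B2 I2]].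
  exists (fun n => P1 n + P2 n); split.
  - intros n; eapply Rle_trans; [apply Rabs_triang|].
    specialize (B1 n); specialize (B2 n); lra.
  - intros n Hn; specialize (I1 n ltac:(lia)); specialize (I2 n ltac:(lia)).
    pose proof (Rmult_le_compat_r _ _ _ (HY1 (S n)) (Rmin_l c1 c2)).
    pose proof (Rmult_le_compat_r _ _ _ (HY2 (S n)) (Rmin_r c1 c2)).
    unfold Rdiv in *; lra.
Qed.

Lemma bulk_cont p q n : cont01 (p n) -> cont01 (q n) ->
  cont01 (fun x => (1 + ((INR n + 1) * x) ^ 2) * (p n x ^ 2 + q n x ^ 2)).
Proof. intros; cont01_tac. Qed.

Lemma bulk_ge0 p q n : cont01 (p n) -> cont01 (q n) -> 0 <= bulk p q n.
Proof.
  intros Hp Hq; apply I01_ge0; [apply bulk_cont; assumption|]; intros x _.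
  apply Rmult_le_pos; [|apply sumsq_ge0].
  pose proof (pow2_ge_0 ((INR n + 1) * x)); lra.
Qed.

Lemma trace0_ge0 p q n : 0 <= trace0 p q n.
Proof. apply sumsq_ge0. Qed.

Lemma is_derive_flux b m t T (l0 l1 : R) (p0 q0 p1 q1 p2 q2 : R -> R) x :
  0 < t -> 0 < T -> l0 = (m - 1) * m / t -> l1 = m * (m + 1) / T ->
  is_derive p0 x (l0 * p1 x) -> is_derive q0 x (l0 * q1 x) ->
  is_derive p1 x (l1 * p2 x) -> is_derive q1 x (l1 * q2 x) ->
  is_derive (fun x => flux b m x t T (p0 x) (q0 x) (p1 x) (q1 x)) x
    (dflux b m x t T (p0 x) (q0 x) (p1 x) (q1 x) (p2 x) (q2 x)).
Proof.
  intros Ht HT E0 E1 H1 H2 H3 H4; unfold flux, dflux, dnorm; rewrite <- E0, <- E1.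
  auto_derive.
  - repeat split; eexists; eassumption.
  - assert (D0 : Derive (fun y : R => p0 y) x = l0 * p1 x) by (apply is_derive_unique, H1).
    assert (D1 : Derive (fun y : R => q0 y) x = l0 * q1 x) by (apply is_derive_unique, H2).
    assert (D2 : Derive (fun y : R => p1 y) x = l1 * p2 x) by (apply is_derive_unique, H3).
    assert (D3 : Derive (fun y : R => q1 y) x = l1 * q2 x) by (apply is_derive_unique, H4).
    rewrite D0, D1, D2, D3.
    unfold Rdiv; ring.
Qed.

Lemma is_derive_flux_right m t T (l0 l1 : R) (p0 q0 p1 q1 p2 q2 : R -> R) x :
  1 < m -> 0 < t -> 0 < T -> l0 = (m - 1) * m / t -> l1 = m * (m + 1) / T ->
  is_derive p0 x (l0 * p1 x) -> is_derive q0 x (l0 * q1 x) ->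
  is_derive p1 x (l1 * p2 x) -> is_derive q1 x (l1 * q2 x) ->
  is_derive (fun x => flux_right m x t (p0 x) (q0 x) (p1 x) (q1 x)) x
    (dflux_right m x t T (p0 x) (q0 x) (p1 x) (q1 x) (p2 x) (q2 x)).
Proof.
  intros Hm Ht HT E0 E1 H1 H2 H3 H4; unfold flux_right, dflux_right, dnorm;
    rewrite <- E0, <- E1.
  auto_derive.
  - repeat split; eexists; eassumption.
  - assert (D0 : Derive (fun y : R => p0 y) x = l0 * p1 x) by (apply is_derive_unique, H1).
    assert (D1 : Derive (fun y : R => q0 y) x = l0 * q1 x) by (apply is_derive_unique, H2).
    assert (D2 : Derive (fun y : R => p1 y) x = l1 * p2 x) by (apply is_derive_unique, H3).
    assert (D3 : Derive (fun y : R => q1 y) x = l1 * q2 x) by (apply is_derive_unique, H4).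
    rewrite D0, D1, D2, D3.
    field; lra.
Qed.

(** The error carries the weight of order [n + 1]; the energy of order [n + 2] has a larger one, and
    the lowest order enters the error unweighted. *)
Lemma error_le_energy sr si lo hi kap K0 K1 rho tau p q h2 n :
  tower sr si lo hi kap K0 K1 rho tau p q h2 ->
  I01 (fun x => (1 + ((INR n + 2) * x) ^ 2)
         * ((p (S n) x ^ 2 + q (S n) x ^ 2) + (p (S (S n)) x ^ 2 + q (S (S n)) x ^ 2))
         + (p n x ^ 2 + q n x ^ 2) + h2 (S n) x)
  <= energy p q n + energy p q (S n) + energy p q (S (S n)) + forcing h2 (S n).
Proof.
  intros HT.
  pose proof (tower_cont_re _ _ _ _ _ _ _ _ _ _ _ _ HT) as Hp.
  pose proof (tower_cont_im _ _ _ _ _ _ _ _ _ _ _ _ HT) as Hq.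
  pose proof (tower_cont_h _ _ _ _ _ _ _ _ _ _ _ _ HT) as Hh.
  apply Rle_trans with (bulk p q n + bulk p q (S n) + bulk p q (S (S n)) + I01 (h2 (S n))).
  - unfold bulk; rewrite <- !I01_plus by cont01_tac.
    apply I01_le; [cont01_tac | cont01_tac |].
    intros x Hx; rewrite !S_INR.
    set (A0 := p n x ^ 2 + q n x ^ 2); set (A1 := p (S n) x ^ 2 + q (S n) x ^ 2);
      set (A2 := p (S (S n)) x ^ 2 + q (S (S n)) x ^ 2).
    assert (0 <= A0) by apply sumsq_ge0. assert (0 <= A2) by apply sumsq_ge0.
    replace (INR n + 1 + 1) with (INR n + 2) by ring.
    replace (INR n + 2 + 1) with (INR n + 3) by ring.
    assert (0 <= ((INR n + 1) * x) ^ 2 * A0)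
      by (apply Rmult_le_pos; [apply pow2_ge_0 | assumption]).
    assert (((INR n + 2) * x) ^ 2 * A2 <= ((INR n + 3) * x) ^ 2 * A2).
    { apply Rmult_le_compat_r; [assumption|]; apply pow_incr.
      destruct Hx; pose proof (pos_INR n); split; nra. }
    nra.
  - unfold energy, forcing.
    pose proof (trace0_ge0 p q n); pose proof (trace0_ge0 p q (S n));
      pose proof (trace0_ge0 p q (S (S n))).
    assert (0 <= h2 (S n) 0).
    { apply (tower_h_ge0 _ _ _ _ _ _ _ _ _ _ _ _ HT); unfold in01; lra. }
    lra.
Qed.

Lemma error_weight_le K n E E' :
  0 <= K -> 0 <= E -> E <= E' -> K / (INR n + 2) * E <= K / (INR n + 1) * E'.
Proof.
  intros HK HE HEE; pose proof (pos_INR n).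
  apply Rmult_le_compat; [apply Rdiv_le_0_compat; lra | assumption | | assumption].
  unfold Rdiv; apply Rmult_le_compat_l; [assumption|].
  apply Rinv_le_contravar; lra.
Qed.

(** At [x = 0] the equation degenerates to [s w_n + tau w_(n-1) = O(1/n)], and [tau <= hi < |s|]
    makes it a contraction. The potential is [hi^2 |w_n(0)|^2]. *)
Lemma trace0_dissipative sr si lo hi kap K0 K1 rho :
  0 < lo -> hi ^ 2 < sr ^ 2 + si ^ 2 -> 0 <= K0 ->
  exists c K, 0 < c /\ 0 <= K /\
  forall tau p q h2, tower sr si lo hi kap K0 K1 rho tau p q h2 ->
    dissipative c K 0 (trace0 p q) (energy p q) (forcing h2).
Proof.
  intros Hlo Hs HK0.
  exists (sr ^ 2 + si ^ 2 - hi ^ 2), (hi ^ 2 + K0 * (1 + Rabs hi) + Rabs hi).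
  pose proof (Rabs_pos hi) as Hhi.
  assert (HKh : 0 <= K0 * (1 + Rabs hi)) by (apply Rmult_le_pos; lra).
  pose proof (pow2_ge_0 hi) as Hhi2.
  split; [lra|]; split; [lra|].
  intros tau p q h2 HT.
  pose proof (tower_cont_re _ _ _ _ _ _ _ _ _ _ _ _ HT) as Hp.
  pose proof (tower_cont_im _ _ _ _ _ _ _ _ _ _ _ _ HT) as Hq.
  pose proof (tower_cont_h _ _ _ _ _ _ _ _ _ _ _ _ HT) as Hh.
  assert (HE : forall n, trace0 p q n <= energy p q n).
  { intros n; unfold energy; pose proof (bulk_ge0 p q n (Hp n) (Hq n)); lra. }
  exists (fun n => hi ^ 2 * trace0 p q n); split.
  - intros n; pose proof (trace0_ge0 p q n); pose proof (trace0_ge0 p q (S n)).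
    rewrite Rabs_pos_eq by (apply Rmult_le_pos; lra).
    pose proof (HE n); pose proof (HE (S n)).
    apply Rmult_le_compat; lra.
  - intros n _.
    pose proof (tower_eq _ _ _ _ _ _ _ _ _ _ _ _ HT n 0 ltac:(unfold in01; lra)) as Heq.
    cbv zeta in Heq; unfold eqre, eqim in Heq.
    pose proof (tower_tau _ _ _ _ _ _ _ _ _ _ _ _ HT (S n)) as Ht.
    set (t := tau (S n)) in *; set (T := tau (S (S n))) in *.
    set (m := INR n + 2) in *.
    assert (Hm : 2 <= m) by (unfold m; pose proof (pos_INR n); lra).
    assert (Hhi' : Rabs hi = hi) by (apply Rabs_pos_eq; lra).
    rewrite Hhi' in *.
    assert (Hh0 : 0 <= h2 (S n) 0).
    { apply (tower_h_ge0 _ _ _ _ _ _ _ _ _ _ _ _ HT); unfold in01; lra. }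
    set (gp := 0 ^ 2 * (m * (m + 1) / T * p (S (S n)) 0) + (2 * (m * 0) + sr) * p (S n) 0
               - si * q (S n) 0 + t * p n 0) in *.
    set (gq := 0 ^ 2 * (m * (m + 1) / T * q (S (S n)) 0) + (2 * (m * 0) + sr) * q (S n) 0
               + si * p (S n) 0 + t * q n 0) in *.
    assert (Id : (sr ^ 2 + si ^ 2) * trace0 p q (S n) = (gp - t * p n 0) ^ 2 + (gq - t * q n 0) ^ 2).
    { unfold gp, gq, trace0; ring. }
    pose proof (young m (- gp) (p n 0) ltac:(lra)) as Y1.
    pose proof (young m (- gq) (q n 0) ltac:(lra)) as Y2.
    set (B0 := trace0 p q n) in *; set (B1 := trace0 p q (S n)) in *.
    assert (HB0 : 0 <= B0) by apply trace0_ge0.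
    assert (HB1 : 0 <= B1) by apply trace0_ge0.
    set (g2 := gp ^ 2 + gq ^ 2) in *.
    assert (Hg2 : 0 <= g2) by apply sumsq_ge0.
    assert (C1 : (gp - t * p n 0) ^ 2 + (gq - t * q n 0) ^ 2
                 <= g2 + t ^ 2 * B0 + t * (m * g2 + B0 / m)).
    { assert (X : 2 * (- gp * p n 0 + - gq * q n 0) <= m * g2 + B0 / m).
      { unfold g2, B0, trace0, Rdiv in *; lra. }
      apply (Rmult_le_compat_l t) in X; [|lra].
      unfold g2, B0, trace0 in *; lra. }
    assert (C2 : t ^ 2 * B0 <= hi ^ 2 * B0).
    { apply Rmult_le_compat_r; [assumption|]; apply pow_incr; lra. }
    assert (HB0m : 0 <= B0 / m) by (apply Rdiv_le_0_compat; lra).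
    assert (C3 : t * (m * g2 + B0 / m) <= hi * (m * g2 + B0 / m)).
    { apply Rmult_le_compat_r; [|lra].
      assert (0 <= m * g2) by (apply Rmult_le_pos; lra); lra. }
    assert (C4 : (1 + hi * m) * g2 <= (1 + hi) * K0 * h2 (S n) 0 / m).
    { apply Rle_trans with ((1 + hi) * m * (K0 / m ^ 2 * h2 (S n) 0)).
      - apply Rmult_le_compat; try lra; nra.
      - right; field; lra. }
    assert (C5 : (sr ^ 2 + si ^ 2 - hi ^ 2) * B1 <= hi ^ 2 * B0 - hi ^ 2 * B1
       + (hi ^ 2 + K0 * (1 + hi) + hi) / m * (B0 + h2 (S n) 0)).
    { assert (D1 : (hi ^ 2 + K0 * (1 + hi) + hi) / m * (B0 + h2 (S n) 0)
         = ((1 + hi) * K0 * h2 (S n) 0 / m + hi * (B0 / m))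
           + ((hi ^ 2 + K0 * (1 + hi)) * (B0 / m) + (hi ^ 2 + hi) * (h2 (S n) 0 / m)))
        by (field; lra).
      rewrite D1.
      assert (0 <= (hi ^ 2 + K0 * (1 + hi)) * (B0 / m)) by (apply Rmult_le_pos; lra).
      assert (0 <= (hi ^ 2 + hi) * (h2 (S n) 0 / m))
        by (apply Rmult_le_pos; [lra | apply Rdiv_le_0_compat; lra]).
      lra. }
    assert (C6 : (hi ^ 2 + K0 * (1 + hi) + hi) / m * (B0 + h2 (S n) 0)
       <= (hi ^ 2 + K0 * (1 + hi) + hi) / (INR n + 1)
          * (energy p q n + energy p q (S n) + energy p q (S (S n)) + forcing h2 (S n))).
    { apply error_weight_le; try lra.
      assert (B0 <= energy p q n) by apply HE.
      assert (B1 <= energy p q (S n)) by apply HE.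
      pose proof (HE (S (S n))); pose proof (trace0_ge0 p q (S (S n))).
      assert (0 <= I01 (h2 (S n))).
      { apply I01_ge0; [auto|]; intros x Hx.
        apply (tower_h_ge0 _ _ _ _ _ _ _ _ _ _ _ _ HT); assumption. }
      unfold forcing; lra. }
    fold B0 B1; lra.
Qed.

(** One sign of the absolute value leaves [2 y^2 + 2 T (b - T)], where [T >= lo] and
    [b - T >= b - hi]. The other leaves [2 (y - a / 2)^2 + 2 (T (T + b) - a^2 / 4)], smallest at
    [T = lo] and [y = a / 2], the point where the real part [2 y - a] vanishes. [c2] and [c1]
    measure these two gaps. *)
Lemma coercivity a b lo hi :
  0 < lo -> lo <= hi -> hi < b -> 0 <= a -> a ^ 2 < 4 * lo * (lo + b) ->
  exists c, 0 < c <= 1 /\ forall T y, lo <= T <= hi -> 0 <= y ->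
    Rabs (a * y - 2 * T ^ 2) <= 2 * T * b - a * y + 2 * y ^ 2 - 2 * c * (1 + y ^ 2).
Proof.
  intros Hlo Hle Hb Ha Hd.
  set (d := 4 * lo * (lo + b) - a ^ 2).
  assert (Hd0 : 0 < d) by (unfold d; lra).
  set (c1 := d / (2 * (2 + a ^ 2))).
  assert (Hc1 : 0 < c1).
  { apply Rdiv_lt_0_compat; [assumption|]; pose proof (pow2_ge_0 a); lra. }
  set (c2 := lo * (b - hi)).
  assert (Hc2 : 0 < c2) by (apply Rmult_lt_0_compat; lra).
  exists (Rmin (1 / 2) (Rmin c1 c2)).
  set (c := Rmin (1 / 2) (Rmin c1 c2)).
  assert (L1 : c <= 1 / 2) by apply Rmin_l.
  assert (L2 : c <= c1) by (eapply Rle_trans; [apply Rmin_r | apply Rmin_l]).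
  assert (L3 : c <= c2) by (eapply Rle_trans; [apply Rmin_r | apply Rmin_r]).
  assert (Hc : 0 < c) by (repeat apply Rmin_pos; lra).
  split; [lra|].
  intros T y HT Hy; apply Rabs_le; split.
  - assert (c2 <= T * (b - T)).
    { unfold c2; apply Rmult_le_compat; lra. }
    assert (0 <= (1 / 2 - c) * y ^ 2) by (apply Rmult_le_pos; [lra | apply pow2_ge_0]).
    pose proof (pow2_ge_0 y); lra.
  - assert (X1 : lo * (lo + b) <= T * (T + b)) by (apply Rmult_le_compat; lra).
    assert (X2 : c * (2 * (2 + a ^ 2)) <= d).
    { apply Rle_trans with (c1 * (2 * (2 + a ^ 2))).
      - apply Rmult_le_compat_r; [pose proof (pow2_ge_0 a); lra | assumption].
      - unfold c1; right; field; pose proof (pow2_ge_0 a); lra. }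
    assert (X3 : 0 <= (1 - 2 * c) * (y - a / 2) ^ 2)
      by (apply Rmult_le_pos; [lra | apply pow2_ge_0]).
    assert (X4 : c * y ^ 2 <= c * (2 * (y - a / 2) ^ 2 + a ^ 2 / 2)).
    { apply Rmult_le_compat_l; [lra|].
      pose proof (pow2_ge_0 (y - a)); lra. }
    unfold d in X2; lra.
Qed.

Lemma potential_bound a b c hi t T y p0 q0 p1 q1 :
  0 <= a -> 0 < b -> 0 < c <= 1 -> 0 < t <= hi -> 0 < T <= hi -> 0 <= y ->
  Rabs (potential c a b t T y p0 q0 p1 q1)
  <= (hi ^ 2 + hi * b + a + 2)
     * ((p0 ^ 2 + q0 ^ 2) + (1 + y ^ 2) * (p1 ^ 2 + q1 ^ 2)).
Proof.
  intros Ha Hb Hc Ht HT Hy; unfold potential.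
  pose proof (cross_bound p0 q0 p1 q1) as HJ.
  set (J := q1 * p0 - p1 * q0) in *.
  pose proof (sumsq_ge0 p0 q0) as HA0; pose proof (sumsq_ge0 p1 q1) as HA1.
  set (A0 := p0 ^ 2 + q0 ^ 2) in *; set (A1 := p1 ^ 2 + q1 ^ 2) in *.
  pose proof (pow2_ge_0 y) as Hy2.
  unfold Rminus at 1; eapply Rle_trans; [apply Rabs_triang|]; rewrite Rabs_Ropp.
  assert (X1 : Rabs (2 * T * t * J) <= hi ^ 2 * (A0 + A1)).
  { rewrite Rabs_mult, (Rabs_pos_eq (2 * T * t)) by (repeat apply Rmult_le_pos; lra).
    replace (hi ^ 2 * (A0 + A1)) with ((2 * hi * hi) * ((A0 + A1) / 2)) by field.
    apply Rmult_le_compat; [repeat apply Rmult_le_pos; lra | apply Rabs_pos | | assumption].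
    apply Rmult_le_compat; lra. }
  assert (X2 : Rabs (((2 * T * b - a * y + 2 * y ^ 2) / 2 - c * (1 + y ^ 2)) * A1)
               <= (hi * b + a + 2) * (1 + y ^ 2) * A1).
  { rewrite Rabs_mult, (Rabs_pos_eq A1) by assumption.
    apply Rmult_le_compat_r; [assumption|].
    assert (0 <= T * b <= hi * b).
    { split; [apply Rmult_le_pos; lra | apply Rmult_le_compat_r; lra]. }
    assert (0 <= a * y <= a * (1 + y ^ 2)).
    { split; [apply Rmult_le_pos; lra | apply Rmult_le_compat_l; [lra|]].
      pose proof (pow2_ge_0 (y - 1)); lra. }
    assert (0 <= c * (1 + y ^ 2) <= 1 + y ^ 2).
    { split; [apply Rmult_le_pos; lra|].
      rewrite <- (Rmult_1_l (1 + y ^ 2)) at 2; apply Rmult_le_compat_r; lra. }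
    assert (0 <= hi * b * y ^ 2) by (apply Rmult_le_pos; lra).
    apply Rabs_le; split; lra. }
  assert (0 <= (hi * b + a + 2) * A0).
  { apply Rmult_le_pos; [|assumption].
    assert (0 <= hi * b) by (apply Rmult_le_pos; lra); lra. }
  assert (0 <= hi ^ 2 * (y ^ 2 * A1))
    by (apply Rmult_le_pos; [apply pow2_ge_0 | apply Rmult_le_pos; lra]).
  lra.
Qed.

Lemma bulk_dissipative_left a b lo hi kap K0 K1 rho :
  0 < lo -> lo <= hi -> hi < b -> 0 <= a -> a ^ 2 < 4 * lo * (lo + b) ->
  0 <= kap -> 0 <= K0 ->
  exists c K n1, 0 < c /\ 0 <= K /\
  forall tau p q h2, tower (- a) b lo hi kap K0 K1 rho tau p q h2 ->
    dissipative c K n1 (bulk p q) (energy p q) (forcing h2).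
Proof.
  intros Hlo Hle Hb Ha Hd Hkap HK0.
  destruct (coercivity a b lo hi Hlo Hle Hb Ha Hd) as [c [Hc Hcoer]].
  set (Ke := (hi + 1) * K0 + hi + kap * b + a + hi * kap + 3 + 2 * hi ^ 2 + b * hi).
  set (Kp := hi ^ 2 + hi * b + a + 2).
  assert (HKp : 0 <= Kp).
  { unfold Kp; pose proof (pow2_ge_0 hi).
    assert (0 <= hi * b) by (apply Rmult_le_pos; lra); lra. }
  assert (HKe : 0 <= Ke).
  { unfold Ke; pose proof (pow2_ge_0 hi).
    assert (0 <= hi * b) by (apply Rmult_le_pos; lra).
    assert (0 <= (hi + 1) * K0) by (apply Rmult_le_pos; lra).
    assert (0 <= kap * b) by (apply Rmult_le_pos; lra).
    assert (0 <= hi * kap) by (apply Rmult_le_pos; lra). lra. }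
  (* From order [n1] on one has [T <= hi <= m], as [flux_nonneg] requires. *)
  destruct (exists_nat_large 0 hi) as [n1 [_ Hn1]].
  exists (2 * c), (Ke + Kp), n1.
  split; [lra|]; split; [lra|].
  intros tau p q h2 HT.
  pose proof (tower_cont_re _ _ _ _ _ _ _ _ _ _ _ _ HT) as Hp.
  pose proof (tower_cont_im _ _ _ _ _ _ _ _ _ _ _ _ HT) as Hq.
  pose proof (tower_cont_h _ _ _ _ _ _ _ _ _ _ _ _ HT) as Hh.
  pose proof (tower_tau _ _ _ _ _ _ _ _ _ _ _ _ HT) as Ht.
  set (pot := fun n x => potential c a b (tau (S n)) (tau (S (S n))) ((INR n + 2) * x)
                           (p n x) (q n x) (p (S n) x) (q (S n) x)).
  assert (Cpot : forall n, cont01 (pot n)).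
  { intros n; unfold pot, potential; cont01_tac. }
  assert (HZ : forall n, 0 <= energy p q n).
  { intros n; unfold energy; pose proof (bulk_ge0 p q n (Hp n) (Hq n));
      pose proof (trace0_ge0 p q n); lra. }
  exists (fun n => I01 (pot n)); split.
  - intros n.
    set (bd := fun x => Kp * ((p n x ^ 2 + q n x ^ 2)
                + (1 + ((INR n + 2) * x) ^ 2) * (p (S n) x ^ 2 + q (S n) x ^ 2))).
    assert (Cbd : cont01 bd) by (unfold bd; cont01_tac).
    assert (Hbd : forall x, in01 x -> Rabs (pot n x) <= bd x).
    { intros x [Hx _]; unfold pot, bd, Kp; pose proof (pos_INR n).
      apply potential_bound; try (pose proof (Ht (S n)); pose proof (Ht (S (S n))); lra).
      apply Rmult_le_pos; lra. }
    assert (Ibd : I01 bd <= Kp * (energy p q n + energy p q (S n))).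
    { unfold bd; rewrite I01_scal by cont01_tac.
      apply Rmult_le_compat_l; [assumption|].
      apply Rle_trans with (bulk p q n + bulk p q (S n)).
      - unfold bulk; rewrite <- I01_plus by cont01_tac.
        apply I01_le; [cont01_tac | cont01_tac |]; intros x _.
        rewrite S_INR; replace (INR n + 1 + 1) with (INR n + 2) by ring.
        pose proof (sumsq_ge0 (p n x) (q n x)).
        assert (0 <= ((INR n + 1) * x) ^ 2 * (p n x ^ 2 + q n x ^ 2))
          by (apply Rmult_le_pos; [apply pow2_ge_0 | assumption]).
        lra.
      - unfold energy; pose proof (trace0_ge0 p q n); pose proof (trace0_ge0 p q (S n)); lra. }
    assert (0 <= Ke * (energy p q n + energy p q (S n))).
    { apply Rmult_le_pos; [assumption|]; pose proof (HZ n); pose proof (HZ (S n)); lra. }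
    assert (U : I01 (pot n) <= I01 bd).
    { apply I01_le; auto; intros x Hx; specialize (Hbd x Hx).
      pose proof (Rle_abs (pot n x)); lra. }
    assert (V : - I01 bd <= I01 (pot n)).
    { replace (- I01 bd) with (I01 (fun x => - 1 * bd x)) by (rewrite I01_scal by assumption; ring).
      apply I01_le; auto; [cont01_tac|]; intros x Hx; specialize (Hbd x Hx).
      pose proof (Rle_abs (- pot n x)) as W; rewrite Rabs_Ropp in W; lra. }
    apply Rabs_le; lra.
  - intros n Hn.
    set (m := INR n + 2).
    set (t := tau (S n)); set (T := tau (S (S n))); set (T2 := tau (S (S (S n)))).
    assert (Htt : lo <= t <= hi) by apply Ht.
    assert (HTT : lo <= T <= hi) by apply Ht.
    assert (HTT2 : lo <= T2 <= hi) by apply Ht.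
    assert (Hm : 2 <= m) by (unfold m; pose proof (pos_INR n); lra).
    set (df := fun x => dflux b m x t T (p n x) (q n x) (p (S n) x) (q (S n) x)
                          (p (S (S n)) x) (q (S (S n)) x)).
    set (f := fun x => flux b m x t T (p n x) (q n x) (p (S n) x) (q (S n) x)).
    assert (Cdf : cont01 df) by (unfold df, dflux, dnorm; cont01_tac).
    assert (Cf : cont01 f) by (unfold f, flux; cont01_tac).
    assert (Idf : 0 <= I01 df).
    { rewrite (I01_derive f df Cf Cdf).
      - assert (0 <= f 1).
        { unfold f; apply flux_nonneg; try lra.
          assert (INR n1 <= INR n) by (apply le_INR; assumption).
          unfold m; lra. }
        assert (f 0 = 0) by (unfold f, flux; unfold Rdiv; ring).
        lra.
      - intros x Hx; unfold f, df.
        apply is_derive_flux with (l0 := (INR n + 1) * (INR n + 2) / tau (S n))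
            (l1 := (INR (S n) + 1) * (INR (S n) + 2) / tau (S (S n))); try lra.
        + unfold m, t; f_equal; ring.
        + rewrite S_INR; unfold m, T; f_equal; ring.
        + apply (tower_derive_re _ _ _ _ _ _ _ _ _ _ _ _ HT n x Hx).
        + apply (tower_derive_im _ _ _ _ _ _ _ _ _ _ _ _ HT n x Hx).
        + apply (tower_derive_re _ _ _ _ _ _ _ _ _ _ _ _ HT (S n) x Hx).
        + apply (tower_derive_im _ _ _ _ _ _ _ _ _ _ _ _ HT (S n) x Hx). }
    set (er := fun x => (1 + (m * x) ^ 2)
         * ((p (S n) x ^ 2 + q (S n) x ^ 2) + (p (S (S n)) x ^ 2 + q (S (S n)) x ^ 2))
         + (p n x ^ 2 + q n x ^ 2) + h2 (S n) x).
    assert (Cer : cont01 er) by (unfold er; cont01_tac).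
    assert (Her : forall x, in01 x -> 0 <= er x).
    { intros x Hx; unfold er.
      pose proof (tower_h_ge0 _ _ _ _ _ _ _ _ _ _ _ _ HT (S n) x Hx).
      pose proof (sumsq_ge0 (p n x) (q n x)).
      pose proof (sumsq_ge0 (p (S n) x) (q (S n) x)).
      pose proof (sumsq_ge0 (p (S (S n)) x) (q (S (S n)) x)).
      pose proof (pow2_ge_0 (m * x)).
      assert (0 <= (1 + (m * x) ^ 2)
         * ((p (S n) x ^ 2 + q (S n) x ^ 2) + (p (S (S n)) x ^ 2 + q (S (S n)) x ^ 2)))
        by (apply Rmult_le_pos; lra).
      lra. }
    set (w := fun x => (1 + (m * x) ^ 2) * (p (S n) x ^ 2 + q (S n) x ^ 2)).
    assert (Cw : cont01 w) by (unfold w; cont01_tac).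
    assert (Iw : bulk p q (S n) = I01 w).
    { apply I01_ext; intros x _; unfold w, m; rewrite S_INR.
      replace (INR n + 1 + 1) with (INR n + 2) by ring; reflexivity. }
    assert (Main : I01 (fun x => 2 * c * w x + df x)
                   <= I01 (fun x => (pot n x - pot (S n) x) + Ke / m * er x)).
    { apply I01_le; [cont01_tac | cont01_tac |].
      intros x Hx; unfold w, df, pot, er, Ke.
      replace (INR (S n) + 2) with (m + 1) by (rewrite S_INR; unfold m; ring).
      fold m t T T2.
      destruct Hx as [Hx0 Hx1].
      rewrite <- Rmult_assoc.
      apply energy_pointwise; try lra.
      - apply (tower_h_ge0 _ _ _ _ _ _ _ _ _ _ _ _ HT); split; assumption.
      - replace m with (INR (S n) + 1) by (rewrite S_INR; unfold m; ring).
        apply (tower_tau_step _ _ _ _ _ _ _ _ _ _ _ _ HT (S n)).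
      - apply (tower_eq _ _ _ _ _ _ _ _ _ _ _ _ HT n x); split; assumption.
      - apply Hcoer; [lra|]; apply Rmult_le_pos; lra. }
    rewrite I01_plus, I01_scal, I01_plus, I01_minus, I01_scal in Main by cont01_tac.
    pose proof (error_le_energy _ _ _ _ _ _ _ _ _ _ _ _ n HT) as HE.
    fold m in HE; fold er in HE.
    pose proof (error_weight_le (Ke + Kp) n _ _ ltac:(lra) (I01_ge0 er Cer Her) HE) as HW.
    fold m in HW.
    assert (Ke / m * I01 er <= (Ke + Kp) / m * I01 er).
    { apply Rmult_le_compat_r; [apply I01_ge0; assumption|].
      unfold Rdiv; apply Rmult_le_compat_r; [|lra].
      left; apply Rinv_0_lt_compat; lra. }
    rewrite Iw; lra.
Qed.

Lemma bulk_dissipative_right a b lo hi kap K0 K1 rho :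
  0 < lo -> 0 < a -> 0 <= K0 ->
  exists c K, 0 < c /\ 0 <= K /\
  forall tau p q h2, tower a b lo hi kap K0 K1 rho tau p q h2 ->
    dissipative c K 0 (bulk p q) (energy p q) (forcing h2).
Proof.
  intros Hlo Ha HK0.
  set (c := Rmin a 2).
  assert (Hc : 0 < c) by (apply Rmin_pos; lra).
  assert (Hca : c <= a) by apply Rmin_l.
  assert (Hc2 : c <= 2) by apply Rmin_r.
  set (Ke := K0 + 4 + hi ^ 2).
  pose proof (pow2_ge_0 hi) as Hhi2.
  exists c, (Ke + hi ^ 2).
  split; [assumption|]; split; [unfold Ke; lra|].
  intros tau p q h2 HT.
  pose proof (tower_cont_re _ _ _ _ _ _ _ _ _ _ _ _ HT) as Hp.
  pose proof (tower_cont_im _ _ _ _ _ _ _ _ _ _ _ _ HT) as Hq.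
  pose proof (tower_cont_h _ _ _ _ _ _ _ _ _ _ _ _ HT) as Hh.
  pose proof (tower_tau _ _ _ _ _ _ _ _ _ _ _ _ HT) as Ht.
  assert (HZ : forall n, 0 <= energy p q n).
  { intros n; unfold energy; pose proof (bulk_ge0 p q n (Hp n) (Hq n));
      pose proof (trace0_ge0 p q n); lra. }
  exists (fun n => 0); split.
  - intros n; rewrite Rabs_R0; apply Rmult_le_pos; [unfold Ke; lra|].
    pose proof (HZ n); pose proof (HZ (S n)); lra.
  - intros n _.
    set (m := INR n + 2).
    set (t := tau (S n)); set (T := tau (S (S n))).
    assert (Htt : lo <= t <= hi) by apply Ht.
    assert (HTT : lo <= T <= hi) by apply Ht.
    assert (Hm : 2 <= m) by (unfold m; pose proof (pos_INR n); lra).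
    set (df := fun x => dflux_right m x t T (p n x) (q n x) (p (S n) x) (q (S n) x)
                          (p (S (S n)) x) (q (S (S n)) x)).
    set (f := fun x => flux_right m x t (p n x) (q n x) (p (S n) x) (q (S n) x)).
    assert (Cdf : cont01 df) by (unfold df, dflux_right, dnorm; cont01_tac).
    assert (Cf : cont01 f) by (unfold f, flux_right; cont01_tac).
    (* Unlike [flux], [flux_right] does not vanish at [x = 0]; what it leaves there is [O(1/m)]
       times [trace0] and joins the errors. *)
    assert (Idf : - (hi ^ 2 / m * trace0 p q n) <= I01 df).
    { rewrite (I01_derive f df Cf Cdf).
      - assert (X : 0 <= t ^ 2 / (2 * (m - 1) * m) <= hi ^ 2 / m).
        { split.
          - apply Rdiv_le_0_compat; [apply pow2_ge_0|].
            apply Rmult_lt_0_compat; lra.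
          - unfold Rdiv; apply Rmult_le_compat.
            + apply pow2_ge_0.
            + left; apply Rinv_0_lt_compat, Rmult_lt_0_compat; lra.
            + apply pow_incr; lra.
            + apply Rinv_le_contravar; [lra|].
              rewrite <- (Rmult_1_l m) at 1; apply Rmult_le_compat_r; lra. }
        assert (0 <= f 1).
        { unfold f, flux_right.
          pose proof (sumsq_ge0 (p n 1) (q n 1)); pose proof (sumsq_ge0 (p (S n) 1) (q (S n) 1)).
          apply Rplus_le_le_0_compat; apply Rmult_le_pos; try assumption; try lra.
          apply Rmult_le_pos; lra. }
        assert (F0 : f 0 = t ^ 2 / (2 * (m - 1) * m) * trace0 p q n)
          by (unfold f, flux_right, trace0; unfold Rdiv; ring).
        pose proof (Rmult_le_compat_r _ _ _ (trace0_ge0 p q n) (proj2 X)).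
        lra.
      - intros x Hx; unfold f, df.
        apply is_derive_flux_right with (l0 := (INR n + 1) * (INR n + 2) / tau (S n))
            (l1 := (INR (S n) + 1) * (INR (S n) + 2) / tau (S (S n))); try lra.
        + unfold m, t; f_equal; ring.
        + rewrite S_INR; unfold m, T; f_equal; ring.
        + apply (tower_derive_re _ _ _ _ _ _ _ _ _ _ _ _ HT n x Hx).
        + apply (tower_derive_im _ _ _ _ _ _ _ _ _ _ _ _ HT n x Hx).
        + apply (tower_derive_re _ _ _ _ _ _ _ _ _ _ _ _ HT (S n) x Hx).
        + apply (tower_derive_im _ _ _ _ _ _ _ _ _ _ _ _ HT (S n) x Hx). }
    set (er := fun x => (1 + (m * x) ^ 2)
         * ((p (S n) x ^ 2 + q (S n) x ^ 2) + (p (S (S n)) x ^ 2 + q (S (S n)) x ^ 2))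
         + (p n x ^ 2 + q n x ^ 2) + h2 (S n) x).
    assert (Cer : cont01 er) by (unfold er; cont01_tac).
    assert (Her : forall x, in01 x -> 0 <= er x).
    { intros x Hx; unfold er.
      pose proof (tower_h_ge0 _ _ _ _ _ _ _ _ _ _ _ _ HT (S n) x Hx).
      pose proof (sumsq_ge0 (p n x) (q n x)).
      pose proof (sumsq_ge0 (p (S n) x) (q (S n) x)).
      pose proof (sumsq_ge0 (p (S (S n)) x) (q (S (S n)) x)).
      pose proof (pow2_ge_0 (m * x)).
      assert (0 <= (1 + (m * x) ^ 2)
         * ((p (S n) x ^ 2 + q (S n) x ^ 2) + (p (S (S n)) x ^ 2 + q (S (S n)) x ^ 2)))
        by (apply Rmult_le_pos; lra).
      lra. }
    set (w := fun x => (1 + (m * x) ^ 2) * (p (S n) x ^ 2 + q (S n) x ^ 2)).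
    assert (Cw : cont01 w) by (unfold w; cont01_tac).
    assert (Iw : bulk p q (S n) = I01 w).
    { apply I01_ext; intros x _; unfold w, m; rewrite S_INR.
      replace (INR n + 1 + 1) with (INR n + 2) by ring; reflexivity. }
    assert (Main : I01 (fun x => c * w x + df x) <= I01 (fun x => Ke / m * er x)).
    { apply I01_le; [cont01_tac | cont01_tac |].
      intros x Hx; unfold w, df, er, Ke.
      destruct Hx as [Hx0 Hx1].
      rewrite <- Rmult_assoc.
      apply energy_pointwise_right with (a := a) (b := b); try lra.
      - apply (tower_h_ge0 _ _ _ _ _ _ _ _ _ _ _ _ HT); split; assumption.
      - apply (tower_eq _ _ _ _ _ _ _ _ _ _ _ _ HT n x); split; assumption. }
    rewrite I01_plus, I01_scal, I01_scal in Main by cont01_tac.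
    pose proof (error_le_energy _ _ _ _ _ _ _ _ _ _ _ _ n HT) as HE.
    fold m in HE; fold er in HE.
    pose proof (error_weight_le Ke n _ _ ltac:(unfold Ke; lra) (I01_ge0 er Cer Her) HE) as HW.
    fold m in HW.
    set (E := energy p q n + energy p q (S n) + energy p q (S (S n)) + forcing h2 (S n)) in *.
    assert (Htr : trace0 p q n <= E).
    { unfold E, energy, forcing.
      pose proof (bulk_ge0 p q n (Hp n) (Hq n)).
      pose proof (bulk_ge0 p q (S n) (Hp _) (Hq _)); pose proof (trace0_ge0 p q (S n)).
      pose proof (bulk_ge0 p q (S (S n)) (Hp _) (Hq _)); pose proof (trace0_ge0 p q (S (S n))).
      assert (0 <= I01 (h2 (S n))).
      { apply I01_ge0; [auto|]; intros x Hx.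
        apply (tower_h_ge0 _ _ _ _ _ _ _ _ _ _ _ _ HT); assumption. }
      assert (0 <= h2 (S n) 0).
      { apply (tower_h_ge0 _ _ _ _ _ _ _ _ _ _ _ _ HT); unfold in01; lra. }
      lra. }
    pose proof (error_weight_le (hi ^ 2) n _ _ Hhi2 (trace0_ge0 p q n) Htr) as HW2.
    fold m in HW2.
    rewrite Iw; unfold Rdiv in *; lra.
Qed.

(** Complex conjugation, which reduces the left half-plane to the case [Im s > 0]. *)
Lemma tower_conj sr si lo hi kap K0 K1 rho tau p q h2 :
  tower sr si lo hi kap K0 K1 rho tau p q h2 ->
  tower sr (- si) lo hi kap K0 K1 rho tau p (fun n x => - q n x) h2.
Proof.
  intros [H1 H2 H3 H4 H5 H6 H7 H8 H9 H10]; constructor; auto.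
  - intros n; cont01_tac.
  - intros n x Hx; rewrite Ropp_mult_distr_r_reverse.
    apply (is_derive_opp (q n)), H7; assumption.
  - intros n x Hx m; specialize (H8 n x Hx); cbv zeta in H8; fold m in H8.
    eapply Rle_trans; [right | exact H8]; unfold eqre, eqim; unfold Rdiv; ring.
  - intros n x Hx; eapply Rle_trans; [apply H10; assumption | right; ring].
Qed.

(** In the right half-plane only the contraction at [x = 0] constrains [s]. In the left one the two
    bounds are the hypotheses of [coercivity] with [a = - Re s] and [b = |Im s|]. *)
Definition admissible (lo hi : R) (s : Cx) : Prop :=
  (0 < Cre s /\ hi ^ 2 < Cnorm2 s) \/
  (Cre s <= 0 /\ hi < Rabs (Cim s) /\ Cre s ^ 2 < 4 * lo * (lo + Rabs (Cim s))).

Lemma bulk_dissipative s lo hi kap K0 K1 rho :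
  0 < lo -> lo <= hi -> admissible lo hi s -> 0 <= kap -> 0 <= K0 ->
  exists c K n1, 0 < c /\ 0 <= K /\
  forall tau p q h2, tower (Cre s) (Cim s) lo hi kap K0 K1 rho tau p q h2 ->
    dissipative c K n1 (bulk p q) (energy p q) (forcing h2).
Proof.
  intros Hlo Hle [[H1 H2]|[H1 [H2 H3]]] Hkap HK0.
  - destruct (bulk_dissipative_right (Cre s) (Cim s) lo hi kap K0 K1 rho) as [c [K H]]; auto.
    exists c, K, 0%nat; assumption.
  - destruct (bulk_dissipative_left (- Cre s) (Rabs (Cim s)) lo hi kap K0 K1 rho)
      as [c [K [n1 [Hc [HK H]]]]]; auto; try lra.
    exists c, K, n1; split; [assumption|]; split; [assumption|].
    intros tau p q h2 HT; rewrite Ropp_involutive in H.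
    unfold Rabs in H; destruct (Rcase_abs (Cim s)).
    + apply tower_conj in HT; specialize (H _ _ _ _ HT).
      assert (Eb : forall n, bulk p (fun n x => - q n x) n = bulk p q n).
      { intros n; apply I01_ext; intros x _; ring. }
      assert (Ee : forall n, energy p (fun n x => - q n x) n = energy p q n).
      { intros n; unfold energy; rewrite Eb; unfold trace0; ring. }
      destruct H as [Phi [B I]]; exists Phi; split.
      * intros n; rewrite <- !Ee; apply B.
      * intros n Hn; rewrite <- !Ee, <- Eb; apply I; assumption.
    + apply H with (1 := HT).
Qed.

(** * The uniform energy bound for towers *)

Lemma energy_ge0 p q n : cont01 (p n) -> cont01 (q n) -> 0 <= energy p q n.
Proof.
  intros Hp Hq; unfold energy.
  pose proof (bulk_ge0 p q n Hp Hq); pose proof (trace0_ge0 p q n); lra.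
Qed.

Lemma admissible_norm lo hi s : 0 < hi -> admissible lo hi s -> hi ^ 2 < Cre s ^ 2 + Cim s ^ 2.
Proof.
  intros Hhi [[_ H]|[_ [H _]]]; [exact H|].
  rewrite <- (pow2_abs (Cim s)); pose proof (pow2_ge_0 (Cre s)).
  assert (hi ^ 2 < Rabs (Cim s) ^ 2) by (simpl; nra).
  lra.
Qed.

(** [n0] and [A] are chosen before the tower and depend on the radii only through [lo], [hi] and
    [kap]; this is the uniformity over tapered sequences. *)
Lemma tower_energy_bound s lo hi kap K0 K1 rho :
  0 < lo -> lo <= hi -> admissible lo hi s ->
  0 <= kap -> 0 <= K0 -> 0 <= K1 -> 0 <= rho < 1 ->
  exists n0 A, 0 <= A /\
  forall tau p q h2, tower (Cre s) (Cim s) lo hi kap K0 K1 rho tau p q h2 ->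
    (forall eps, 0 < eps -> exists M0, forall M, (M0 <= M)%nat -> energy p q M < eps) ->
    forall M, sum_f_R0 (fun i => energy p q (S (n0 + i))) M
              <= A * (energy p q n0 + energy p q (S n0) + forcing h2 n0).
Proof.
  intros Hlo Hle Hs Hkap HK0 HK1 Hrho.
  destruct (bulk_dissipative s lo hi kap K0 K1 rho) as [c1 [Ka [n1 [Hc1 [HKa D1]]]]]; auto.
  destruct (trace0_dissipative (Cre s) (Cim s) lo hi kap K0 K1 rho)
    as [c2 [Kb [Hc2 [HKb D2]]]]; auto.
  { apply admissible_norm with lo; [lra | assumption]. }
  set (K := Ka + Kb + K1).
  destruct (absorption (Rmin c1 c2) K rho (Nat.max n1 0)) as [n0 [A [_ [HA Habs]]]].
  { apply Rmin_pos; assumption. }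
  { unfold K; lra. }
  { assumption. }
  exists n0, A; split; [assumption|].
  intros tau p q h2 HT Hlim.
  pose proof (tower_cont_re _ _ _ _ _ _ _ _ _ _ _ _ HT) as Hp.
  pose proof (tower_cont_im _ _ _ _ _ _ _ _ _ _ _ _ HT) as Hq.
  pose proof (tower_cont_h _ _ _ _ _ _ _ _ _ _ _ _ HT) as Hh.
  assert (HZ : forall n, 0 <= energy p q n) by (intros; apply energy_ge0; auto).
  assert (HI : forall n, 0 <= I01 (h2 n)).
  { intros n; apply I01_ge0; [auto|]; intros x Hx.
    apply (tower_h_ge0 _ _ _ _ _ _ _ _ _ _ _ _ HT); assumption. }
  assert (HH : forall n, 0 <= forcing h2 n).
  { intros n; unfold forcing; pose proof (HI n).
    assert (0 <= h2 n 0)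
      by (apply (tower_h_ge0 _ _ _ _ _ _ _ _ _ _ _ _ HT); unfold in01; lra).
    lra. }
  destruct (dissipative_add c1 c2 Ka Kb n1 0 (bulk p q) (trace0 p q) (energy p q) (forcing h2))
    as [Phi [B I]].
  { intros; apply bulk_ge0; auto. }
  { intros; apply trace0_ge0. }
  { apply D1 with (1 := HT). }
  { apply D2 with (1 := HT). }
  apply (Habs (energy p q) (forcing h2) Phi HZ HH); [| | | assumption].
  - intros n; eapply Rle_trans; [apply B|].
    apply Rmult_le_compat_r; [|unfold K; lra].
    pose proof (HZ n); pose proof (HZ (S n)); lra.
  - intros n Hn; eapply Rle_trans; [apply (I n Hn)|].
    apply Rplus_le_compat_l, Rmult_le_compat_r.
    + pose proof (HZ n); pose proof (HZ (S n)); pose proof (HZ (S (S n))); pose proof (HH (S n)).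
      lra.
    + unfold Rdiv; apply Rmult_le_compat_r; [|unfold K; lra].
      left; apply Rinv_0_lt_compat; pose proof (pos_INR n); lra.
  - intros n.
    pose proof (tower_h_step _ _ _ _ _ _ _ _ _ _ _ _ HT n) as Hst.
    assert (X1 : I01 (h2 (S n)) <= rho * I01 (h2 n) + K1 * bulk p q n).
    { unfold bulk.
      rewrite <- (I01_scal rho), <- (I01_scal K1), <- I01_plus by cont01_tac.
      apply I01_le; [cont01_tac | cont01_tac |]; intros x Hx.
      eapply Rle_trans; [apply Hst; assumption|].
      apply Rplus_le_compat_l, Rmult_le_compat_l; [assumption|].
      pose proof (sumsq_ge0 (p n x) (q n x)).
      assert (0 <= ((INR n + 1) * x) ^ 2 * (p n x ^ 2 + q n x ^ 2))
        by (apply Rmult_le_pos; [apply pow2_ge_0 | assumption]).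
      lra. }
    assert (X2 : h2 (S n) 0 <= rho * h2 n 0 + K1 * trace0 p q n)
      by (apply Hst; unfold in01; lra).
    assert (0 <= (Ka + Kb) * energy p q n) by (apply Rmult_le_pos; [lra | auto]).
    unfold forcing, K; unfold energy in *; lra.
Qed.

(** * From the regions of the spectral parameter to the conditions of the energy estimate *)

Lemma Cmod_sqr s : Cmod s ^ 2 = Cnorm2 s.
Proof. unfold Cmod; rewrite pow2_sqrt; [reflexivity | apply sumsq_ge0]. Qed.

(** [Omega1] is used at the larger radius, the alternative of [Omega2] and [Omega3] at the smaller
    one. Write [a = - Re s], [b = |Im s|], [r = |s|]. In the left half-plane [Omega2] gives
    [a < 2 sigma], because [r / (r - a) >= 1]. [Omega3], with [t = a / r], expands to [a^2 / 4 +
    sigma^2 + sigma^2 (1 - t)^2 < sigma r (1 - t^2)], and [r (1 - t^2) <= b] since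
    [b = r sqrt (1 - t^2)]. *)
Lemma Omega_admissible sigma sigma' s :
  0 < sigma -> sigma < sigma' -> Omega sigma s -> Omega sigma' s -> admissible sigma sigma' s.
Proof.
  intros H0 Hlt [_ H23] [H1 _]; unfold Omega2, Omega3 in H23.
  destruct H1 as [[Ha Hb]|[Ha Hb]].
  2: { left; split; [assumption|].
       rewrite <- Cmod_sqr; simpl; nra. }
  right; split; [assumption|]; split; [assumption|].
  pose proof (Cmod_sqr s) as Hr; unfold Cnorm2 in Hr.
  rewrite <- (pow2_abs (Cim s)) in Hr.
  set (a := - Cre s); assert (Ea : Cre s = - a) by (unfold a; ring).
  assert (Ha0 : 0 <= a) by (unfold a; lra).
  set (b := Rabs (Cim s)) in *.
  rewrite Ea in *; clear Ea Ha; clearbody a.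
  assert (Hr0 : 0 <= Cmod s) by apply sqrt_pos.
  set (r := Cmod s) in *; clearbody r.
  assert (Hr1 : 0 < r) by nra.
  assert (Hbr : b <= r) by nra.
  assert (Hsb : 0 < sigma * b) by (apply Rmult_lt_0_compat; lra).
  destruct H23 as [[K1 K2]|[_ K]].
  - assert (X : a / 2 <= - - a * r / (2 * (r + - a))).
    { apply Rmult_le_reg_r with (2 * (r + - a)); [lra|].
      replace (- - a * r / (2 * (r + - a)) * (2 * (r + - a))) with (a * r) by (field; lra).
      nra. }
    assert (a < 2 * sigma) by lra.
    nra.
  - set (t := a / r).
    assert (Et : a = t * r) by (unfold t; field; lra).
    replace (- a / r) with (- t) in K by (unfold t; field; lra).
    assert (B2 : r * (1 - t ^ 2) <= b).
    { apply Rmult_le_reg_r with r; [lra|].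
      replace (r * (1 - t ^ 2) * r) with (b ^ 2) by (rewrite Et in Hr; nra).
      nra. }
    apply (Rmult_le_compat_l sigma) in B2; [|lra].
    assert (0 <= sigma ^ 2 * (1 - t) ^ 2) by (apply Rmult_le_pos; apply pow2_ge_0).
    assert (0 < sigma ^ 2) by (simpl; nra).
    rewrite Et in *; nra.
Qed.

(** * Derivatives of products and of the equation *)

(** A real counterpart of [derivs] in which derivatives are two-sided and hence required only
    inside, with continuity up to the ends; a complex sequence is treated as a pair of jets. *)
Definition jet (f : nat -> R -> R) : Prop :=
  (forall n, cont01 (f n)) /\
  forall n x, 0 < x < 1 -> is_derive (f n) x (f (S n) x).

Lemma Rabs_Cre_le z : Rabs (Cre z) <= Cmod z.
Proof.
  unfold Cmod, Cnorm2; rewrite <- sqrt_Rsqr_abs; apply sqrt_le_1_alt.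
  unfold Rsqr; pose proof (pow2_ge_0 (Cim z)); lra.
Qed.

Lemma Rabs_Cim_le z : Rabs (Cim z) <= Cmod z.
Proof.
  unfold Cmod, Cnorm2; rewrite <- sqrt_Rsqr_abs; apply sqrt_le_1_alt.
  unfold Rsqr; pose proof (pow2_ge_0 (Cre z)); lra.
Qed.

Lemma has_deriv01_Cre f l x : has_deriv01 f l x -> has_deriv01R (fun t => Cre (f t)) (Cre l) x.
Proof.
  intros H eps Heps; destruct (H eps Heps) as [d [Hd Hb]].
  exists d; split; [assumption|]; intros h Hh Hlt Hin.
  eapply Rle_lt_trans; [|apply (Hb h Hh Hlt Hin)].
  eapply Rle_trans; [|apply Rabs_Cre_le].
  right; f_equal; unfold Csub, Cscal, Cre; simpl; unfold Rdiv; ring.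
Qed.

Lemma has_deriv01_Cim f l x : has_deriv01 f l x -> has_deriv01R (fun t => Cim (f t)) (Cim l) x.
Proof.
  intros H eps Heps; destruct (H eps Heps) as [d [Hd Hb]].
  exists d; split; [assumption|]; intros h Hh Hlt Hin.
  eapply Rle_lt_trans; [|apply (Hb h Hh Hlt Hin)].
  eapply Rle_trans; [|apply Rabs_Cim_le].
  right; f_equal; unfold Csub, Cscal, Cim; simpl; unfold Rdiv; ring.
Qed.

Lemma derivs_jet u D : derivs u D ->
  jet (fun n x => Cre (D n x)) /\ jet (fun n x => Cim (D n x)).
Proof.
  intros [_ H]; split; split.
  - intros n; apply has_deriv01R_cont01 with (fun x => Cre (D (S n) x)).
    intros x Hx; apply has_deriv01_Cre, H; assumption.
  - intros n x Hx; apply has_deriv01R_is_derive; [assumption|].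
    apply has_deriv01_Cre, H; unfold in01; lra.
  - intros n; apply has_deriv01R_cont01 with (fun x => Cim (D (S n) x)).
    intros x Hx; apply has_deriv01_Cim, H; assumption.
  - intros n x Hx; apply has_deriv01R_is_derive; [assumption|].
    apply has_deriv01_Cim, H; unfold in01; lra.
Qed.

Lemma is_derive_eq_open (f g : R -> R) (f' g' x : R) : 0 < x < 1 ->
  (forall y, in01 y -> f y = g y) -> is_derive f x f' -> is_derive g x g' -> f' = g'.
Proof.
  intros Hx E Hf Hg.
  assert (Hg' : is_derive g x f').
  { apply is_derive_ext_loc with f; [|assumption].
    assert (Hd : 0 < Rmin x (1 - x)) by (apply Rmin_pos; lra).
    exists (mkposreal _ Hd); intros y Hy; apply E.
    change (Rabs (y - x) < Rmin x (1 - x)) in Hy.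
    pose proof (Rmin_l x (1 - x)); pose proof (Rmin_r x (1 - x)).
    unfold in01; unfold Rabs in Hy; destruct Rcase_abs in Hy; lra. }
  apply is_derive_unique in Hg'; apply is_derive_unique in Hg; congruence.
Qed.

Lemma jet_unique f g : jet f -> jet g -> (forall x, in01 x -> f 0%nat x = g 0%nat x) ->
  forall n x, in01 x -> f n x = g n x.
Proof.
  intros [Cf Df] [Cg Dg] E0; induction n as [|n IH]; [assumption|].
  apply cont01_eq_closed; auto.
  intros x Hx; apply (is_derive_eq_open (f n) (g n) _ _ x); auto.
Qed.

(** [in_kernel] draws its derivative sequences from separate existentials; this identifies them. *)
Lemma derivs_unique u D D' : derivs u D -> derivs u D' ->
  forall n x, in01 x -> D n x = D' n x.
Proof.
  intros H H' n x Hx.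
  destruct (derivs_jet u D H) as [Jr Ji], (derivs_jet u D' H') as [Jr' Ji'].
  destruct H as [E _], H' as [E' _].
  pose proof (jet_unique _ _ Jr Jr'
    ltac:(intros y Hy; cbv beta; rewrite E, E' by assumption; reflexivity) n x Hx) as X1.
  pose proof (jet_unique _ _ Ji Ji'
    ltac:(intros y Hy; cbv beta; rewrite E, E' by assumption; reflexivity) n x Hx) as X2.
  unfold Cre, Cim in *; destruct (D n x), (D' n x); simpl in *; subst; reflexivity.
Qed.

(* Unlike [Binomial.C], this vanishes for [k > n]. *)
Fixpoint bin (n k : nat) : R :=
  match n, k with
  | _, O => 1
  | O, S _ => 0
  | S n', S k' => bin n' k' + bin n' (S k')
  end.

Lemma bin_0 n : bin n 0 = 1.
Proof. destruct n; reflexivity. Qed.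

Lemma bin_gt n k : (n < k)%nat -> bin n k = 0.
Proof.
  revert k; induction n as [|n IH]; intros [|k] H; try lia; simpl; [reflexivity|].
  rewrite !IH by lia; ring.
Qed.

Lemma bin_ge0 n k : 0 <= bin n k.
Proof.
  revert k; induction n as [|n IH]; intros [|k]; simpl; try lra.
  pose proof (IH k); pose proof (IH (S k)); lra.
Qed.

Lemma bin_fact j d : bin (j + d) j * (INR (fact j) * INR (fact d)) = INR (fact (j + d)).
Proof.
  remember (j + d)%nat as n eqn:E; revert j d E.
  induction n as [|n IH]; intros j d E.
  - assert (j = 0 /\ d = 0)%nat as [-> ->] by lia; simpl; ring.
  - destruct j as [|j].
    { rewrite bin_0; simpl in E; subst d; simpl fact; simpl INR; ring. }
    cbn [bin].
    destruct d as [|d].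
    + rewrite (bin_gt n (S j)) by lia.
      pose proof (IH j 0%nat ltac:(lia)) as X.
      assert (n = j) by lia; subst n.
      rewrite !fact_simpl, !mult_INR.
      transitivity (INR (S j) * (bin j j * (INR (fact j) * INR (fact 0))));
        [ring | rewrite X; ring].
    + pose proof (IH j (S d) ltac:(lia)) as X1.
      pose proof (IH (S j) d ltac:(lia)) as X2.
      rewrite (fact_simpl n), mult_INR.
      rewrite (fact_simpl j), (mult_INR (S j)) in X2 |- *.
      rewrite (fact_simpl d), (mult_INR (S d)) in X1 |- *.
      assert (En : INR (S n) = INR (S j) + INR (S d)) by (rewrite <- plus_INR; f_equal; lia).
      rewrite En.
      transitivity (INR (S j) * (bin n j * (INR (fact j) * (INR (S d) * INR (fact d))))
        + INR (S d) * (bin n (S j) * (INR (S j) * INR (fact j) * INR (fact d))));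
        [ring | rewrite X1, X2; ring].
Qed.

(** * The Leibniz rule and the differentiated equation *)

Definition leib (f g : nat -> R -> R) (n : nat) (x : R) : R :=
  sum_f_R0 (fun k => bin n k * (f (n - k)%nat x * g k x)) n.

Lemma is_derive_sum_f_R0 (F : nat -> R -> R) (F' : nat -> R) (x : R) n :
  (forall k, is_derive (F k) x (F' k)) ->
  is_derive (fun t => sum_f_R0 (fun k => F k t) n) x (sum_f_R0 F' n).
Proof.
  intros H; induction n as [|n IH]; simpl; [apply H|].
  apply (is_derive_plus (fun t => sum_f_R0 (fun k => F k t) n) (F (S n))); auto.
Qed.

(** Pascal's rule; the vanishing of [bin n (S n)] lets both halves be summed over matching
    ranges. *)
Lemma leib_pascal (a b : nat -> R) n :
  sum_f_R0 (fun k => bin n k * (a (S (n - k)) * b k + a (n - k)%nat * b (S k))) n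
  = sum_f_R0 (fun k => bin (S n) k * (a (S n - k)%nat * b k)) (S n).
Proof.
  rewrite (decomp_sum _ (S n)) by lia.
  cbn [pred]; rewrite bin_0, Nat.sub_0_r.
  transitivity (sum_f_R0 (fun k => bin n k * (a (S n - k)%nat * b k)) (S n)
                + sum_f_R0 (fun k => bin n k * (a (n - k)%nat * b (S k))) n).
  - rewrite tech5, bin_gt by lia; rewrite Rmult_0_l, Rplus_0_r, <- sum_plus.
    apply sum_eq; intros k Hk.
    replace (S n - k)%nat with (S (n - k)) by lia; ring.
  - rewrite (decomp_sum _ (S n)) by lia.
    cbn [pred]; rewrite bin_0, Nat.sub_0_r, Rplus_assoc; f_equal.
    rewrite <- sum_plus; apply sum_eq; intros k Hk.
    cbn [bin]; replace (S n - S k)%nat with (n - k)%nat by lia; ring.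
Qed.

Lemma leib_jet f g : jet f -> jet g -> jet (leib f g).
Proof.
  intros [Cf Df] [Cg Dg]; split.
  - intros n; unfold leib; cont01_tac.
  - intros n x Hx; unfold leib at 2.
    rewrite <- (leib_pascal (fun k => f k x) (fun k => g k x)).
    apply (is_derive_sum_f_R0 (fun k t => bin n k * (f (n - k)%nat t * g k t))).
    intros k; apply (is_derive_scal (fun t => f (n - k)%nat t * g k t)).
    apply (is_derive_mult (f (n - k)%nat) (g k)); auto.
    intros; apply Rmult_comm.
Qed.

Lemma jet_plus f g : jet f -> jet g -> jet (fun n x => f n x + g n x).
Proof.
  intros [Cf Df] [Cg Dg]; split; [intros n; cont01_tac|].
  intros n x Hx; apply (is_derive_plus (f n) (g n)); auto.
Qed.

Lemma jet_minus f g : jet f -> jet g -> jet (fun n x => f n x - g n x).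
Proof.
  intros [Cf Df] [Cg Dg]; split; [intros n; cont01_tac|].
  intros n x Hx; apply (is_derive_minus (f n) (g n)); auto.
Qed.

(** A derivative falling on [x^2] adds [2 x f^(n+2)], and one falling on [2 (n + 1) x] adds
    [2 (n + 1) f^(n+1)], which takes [n (n + 1)] to [(n + 1) (n + 2)]. *)
Lemma differentiated_equation f g r (sr k : R) : jet f -> jet g -> jet r ->
  (forall x, in01 x ->
     x ^ 2 * f 2%nat x + (2 * x + sr) * f 1%nat x + k * g 1%nat x = r 0%nat x) ->
  forall n x, in01 x ->
    x ^ 2 * f (S (S n)) x + (2 * (INR n + 1) * x + sr) * f (S n) x + k * g (S n) x
    + INR n * (INR n + 1) * f n x = r n x.
Proof.
  intros [Cf Df] [Cg Dg] [Cr Dr] H0; induction n as [|n IH]; intros x Hx.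
  - rewrite <- (H0 x Hx); simpl INR; ring.
  - revert x Hx; apply cont01_eq_closed; [cont01_tac | cont01_tac |].
    intros x Hx.
    apply (is_derive_eq_open _ (r n) _ _ x Hx IH); [|apply Dr; assumption].
    assert (D0 : Derive (fun y : R => f n y) x = f (S n) x) by (apply is_derive_unique; auto).
    assert (D1 : Derive (fun y : R => f (S n) y) x = f (S (S n)) x)
      by (apply is_derive_unique; auto).
    assert (D2 : Derive (fun y : R => f (S (S n)) y) x = f (S (S (S n))) x)
      by (apply is_derive_unique; auto).
    assert (D3 : Derive (fun y : R => g (S n) y) x = g (S (S n)) x)
      by (apply is_derive_unique; auto).
    auto_derive.
    + repeat split; eexists; eauto.
    + rewrite D0, D1, D2, D3, S_INR; ring.
Qed.

(** * Normalised derivatives of a solution *)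

Fixpoint omega (t : nat -> R) (n : nat) : R :=
  match n with
  | O => 1
  | S n' => t (S n') * omega t n'
  end.

(** For a constant radius its square is the coefficient [gcoef] of the norms. *)
Definition weight (t : nat -> R) (n : nat) : R :=
  omega t n / (INR (fact n) * INR (fact (S n))).

Definition normalised (t : nat -> R) (f : nat -> R -> R) (n : nat) (x : R) : R :=
  weight t n * f (S n) x.

(** The normalised family starts at [u'], whereas [W u] also involves [u] itself; hence [u] takes
    place [0] and the other indices are shifted by one. *)
Definition amplitude (t : nat -> R) (f g : nat -> R -> R) (k : nat) (x : R) : R :=
  match k with
  | O => sqrt (f 0%nat x ^ 2 + g 0%nat x ^ 2)
  | S j => sqrt (normalised t f j x ^ 2 + normalised t g j x ^ 2)
  end.

(** A geometric majorant for the Leibniz convolution with the derivatives of the potential; [rho]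
    will be the ratio of [hi] to the Gevrey radius of [W]. *)
Definition memory (rho : R) (t : nat -> R) (f g : nat -> R -> R) (n : nat) (x : R) : R :=
  sum_f_R0 (fun k => rho ^ (n - k) * amplitude t f g k x) n.

Lemma INR_fact_pos n : 0 < INR (fact n).
Proof. apply lt_0_INR, lt_O_fact. Qed.

Lemma fact_mul_le a b : INR (fact a) * INR (fact b) <= INR (fact (a + b)).
Proof.
  rewrite <- mult_INR; apply le_INR.
  induction a as [|a IH]; [simpl; lia|].
  change (fact (S a + b)) with (fact (S (a + b))); rewrite !fact_simpl.
  rewrite <- Nat.mul_assoc; apply Nat.mul_le_mono; lia.
Qed.

Lemma omega_pos t lo n : 0 < lo -> (forall n, lo <= t n) -> 0 < omega t n.
Proof.
  intros Hlo Ht; induction n as [|n IH]; simpl; [lra|].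
  apply Rmult_lt_0_compat; [pose proof (Ht (S n)); lra | assumption].
Qed.

Lemma weight_pos t lo n : 0 < lo -> (forall n, lo <= t n) -> 0 < weight t n.
Proof.
  intros Hlo Ht; apply Rdiv_lt_0_compat; [apply omega_pos with lo; assumption|].
  apply Rmult_lt_0_compat; apply INR_fact_pos.
Qed.

(** This ratio of consecutive weights turns the term [n (n + 1) f_n] of the differentiated equation
    into [tau w_(n-1)]. *)
Lemma weight_step t lo n : 0 < lo -> (forall n, lo <= t n) ->
  weight t n = (INR n + 1) * (INR n + 2) / t (S n) * weight t (S n).
Proof.
  intros Hlo Ht; unfold weight.
  rewrite (fact_simpl (S n)), (fact_simpl n), !mult_INR, !S_INR; cbn [omega].
  pose proof (INR_fact_pos n); pose proof (pos_INR n); pose proof (Ht (S n)).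
  field; repeat split; try lra.
Qed.

Lemma omega_shift_le t lo hi j d : 0 < lo -> (forall n, lo <= t n <= hi) ->
  omega t (d + j) <= hi ^ d * omega t j.
Proof.
  intros Hlo Ht; induction d as [|d IH]; simpl; [lra|].
  pose proof (Ht (S (d + j))); rewrite Rmult_assoc.
  apply Rmult_le_compat; try lra.
  left; apply omega_pos with lo; [assumption|]; intros n; apply Ht.
Qed.

(** After cancellation this is [d! j! <= n!] with [n = j + 1 + d]; the factor [1 / (n + 1)] remains
    from the [(n + 1)!] in the weight. *)
Lemma weight_binomial_le t lo hi j d : 0 < lo -> (forall n, lo <= t n <= hi) ->
  weight t (S j + d) * (bin (S j + d) (S j) * INR (fact d) ^ 2)
  <= hi / (INR (S j + d) + 1) * hi ^ d * weight t j.
Proof.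
  intros Hlo Ht; unfold weight.
  set (n := (S j + d)%nat).
  assert (E : bin n (S j) = INR (fact n) / (INR (fact (S j)) * INR (fact d))).
  { unfold n; rewrite <- bin_fact; field; split; apply INR_fact_neq_0. }
  rewrite E, (fact_simpl n), mult_INR, S_INR.
  pose proof (INR_fact_pos n) as Hn; pose proof (INR_fact_pos j) as Hj;
    pose proof (INR_fact_pos d) as Hd; pose proof (INR_fact_pos (S j)) as HSj.
  pose proof (pos_INR n) as Hn0.
  assert (Ho : omega t n <= hi ^ S d * omega t j).
  { replace n with (S d + j)%nat by (unfold n; lia); apply omega_shift_le with lo; assumption. }
  assert (Hw : 0 < omega t j)
    by (apply omega_pos with lo; [assumption|]; intros k; apply Ht).
  assert (Hf : INR (fact d) * INR (fact j) <= INR (fact n)).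
  { eapply Rle_trans; [apply fact_mul_le|]; apply le_INR, fact_le; unfold n; lia. }
  assert (Hh : 0 <= hi ^ S d * omega t j).
  { apply Rmult_le_pos; [apply pow_le; pose proof (Ht 0%nat); lra | lra]. }
  set (B := / ((INR n + 1) * INR (fact (S j)) * INR (fact n) * INR (fact j))).
  assert (HB : 0 < B) by (apply Rinv_0_lt_compat; repeat apply Rmult_lt_0_compat; lra).
  replace (omega t n / (INR (fact n) * ((INR n + 1) * INR (fact n)))
     * (INR (fact n) / (INR (fact (S j)) * INR (fact d)) * INR (fact d) ^ 2))
    with (B * (omega t n * (INR (fact d) * INR (fact j)))) by (unfold B; field; lra).
  replace (hi / (INR n + 1) * hi ^ d * (omega t j / (INR (fact j) * INR (fact (S j)))))
    with (B * ((hi ^ S d * omega t j) * INR (fact n))) by (unfold B; change (hi ^ S d) with (hi * hi ^ d); field; lra).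
  apply Rmult_le_compat_l; [lra|].
  apply Rmult_le_compat; try lra.
  - left; apply omega_pos with lo; [assumption|]; intros k; apply Ht.
  - apply Rmult_le_pos; lra.
Qed.

Lemma weight_fact_le t lo hi n : 0 < lo -> (forall n, lo <= t n <= hi) ->
  weight t n * INR (fact n) ^ 2 <= hi ^ n / (INR n + 1).
Proof.
  intros Hlo Ht; unfold weight; rewrite (fact_simpl n), mult_INR, S_INR.
  pose proof (INR_fact_pos n); pose proof (pos_INR n).
  replace (omega t n / (INR (fact n) * ((INR n + 1) * INR (fact n))) * INR (fact n) ^ 2)
    with (omega t n / (INR n + 1)) by (field; lra).
  unfold Rdiv; apply Rmult_le_compat_r; [left; apply Rinv_0_lt_compat; lra|].
  pose proof (omega_shift_le t lo hi 0 n Hlo Ht) as X; rewrite Nat.add_0_r in X; simpl in X.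
  lra.
Qed.

Lemma Rabs_le_sqrt_l a b : Rabs a <= sqrt (a ^ 2 + b ^ 2).
Proof. apply (Rabs_Cre_le (a, b)). Qed.

Lemma Rabs_le_sqrt_r a b : Rabs b <= sqrt (a ^ 2 + b ^ 2).
Proof. apply (Rabs_Cim_le (a, b)). Qed.

Lemma amplitude_sqr t f g j x :
  amplitude t f g (S j) x ^ 2 = normalised t f j x ^ 2 + normalised t g j x ^ 2.
Proof. simpl amplitude; rewrite pow2_sqrt; [reflexivity | apply sumsq_ge0]. Qed.

Lemma memory_step rho t f g n x :
  memory rho t f g (S n) x = rho * memory rho t f g n x + amplitude t f g (S n) x.
Proof.
  unfold memory; rewrite tech5, Nat.sub_diag, pow_O, Rmult_1_l; f_equal.
  rewrite scal_sum; apply sum_eq; intros k Hk.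
  replace (S n - k)%nat with (S (n - k)) by lia; simpl; ring.
Qed.

(** Convexity of the square, with weights [rho] and [1 - rho], at the points [h] and
    [a / (1 - rho)]. *)
Lemma memory_sqr_step rho t f g n x : 0 <= rho < 1 ->
  memory rho t f g (S n) x ^ 2 <= rho * memory rho t f g n x ^ 2
    + / (1 - rho) * (normalised t f n x ^ 2 + normalised t g n x ^ 2).
Proof.
  intros Hr; rewrite memory_step, <- amplitude_sqr.
  set (h := memory rho t f g n x); set (a := amplitude t f g (S n) x).
  assert (E : rho * h ^ 2 + / (1 - rho) * a ^ 2 - (rho * h + a) ^ 2
              = rho / (1 - rho) * ((1 - rho) * h - a) ^ 2) by (field; lra).
  assert (0 <= rho / (1 - rho) * ((1 - rho) * h - a) ^ 2).
  { apply Rmult_le_pos; [apply Rdiv_le_0_compat; lra | apply pow2_ge_0]. }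
  lra.
Qed.

(* Both the Gevrey bound of order 2 on the potential and the weights are in scale with
   [n!^2]; the binomial coefficients leave a gain of [1/n]. *)
Lemma leib_weight_le t lo hi sstar Kw (v g f1 f2 : nat -> R -> R) n x :
  0 < lo -> (forall n, lo <= t n <= hi) -> 0 < sstar -> 0 <= Kw ->
  (forall m, Rabs (v m x) <= Kw * (/ sstar) ^ m * INR (fact m) ^ 2) ->
  (forall k, Rabs (g k x) <= sqrt (f1 k x ^ 2 + f2 k x ^ 2)) ->
  Rabs (weight t n * leib v g n x)
  <= Kw * (1 + hi) / (INR n + 1) * memory (hi / sstar) t f1 f2 n x.
Proof.
  intros Hlo Ht Hs HK Hv Hg.
  assert (Hhi : 0 < hi) by (pose proof (Ht 0%nat); lra).
  assert (Hw : forall n, 0 < weight t n)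
    by (intros k; apply weight_pos with lo; [assumption|]; intros i; apply Ht).
  assert (His : 0 < / sstar) by (apply Rinv_0_lt_compat; assumption).
  pose proof (pos_INR n) as Hn0.
  unfold leib, memory; rewrite scal_sum, scal_sum.
  eapply Rle_trans; [apply Rsum_abs|].
  apply sum_Rle; intros k Hk.
  set (d := (n - k)%nat).
  assert (Habs : Rabs (bin n k * (v d x * g k x) * weight t n)
     <= weight t n * (bin n k * (Kw * (/ sstar) ^ d * INR (fact d) ^ 2))
        * sqrt (f1 k x ^ 2 + f2 k x ^ 2)).
  { rewrite !Rabs_mult, (Rabs_pos_eq (bin n k)) by apply bin_ge0.
    rewrite (Rabs_pos_eq (weight t n)) by (left; apply Hw).
    replace (bin n k * (Rabs (v d x) * Rabs (g k x)) * weight t n)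
      with (weight t n * (bin n k * Rabs (v d x)) * Rabs (g k x)) by ring.
    apply Rmult_le_compat; [| apply Rabs_pos | | apply Hg].
    - apply Rmult_le_pos; [left; apply Hw|].
      apply Rmult_le_pos; [apply bin_ge0 | apply Rabs_pos].
    - apply Rmult_le_compat_l; [left; apply Hw|].
      apply Rmult_le_compat_l; [apply bin_ge0 | apply Hv]. }
  eapply Rle_trans; [exact Habs|].
  assert (Hsd : 0 < (/ sstar) ^ d) by (apply pow_lt; assumption).
  assert (Erho : (hi / sstar) ^ d = hi ^ d * (/ sstar) ^ d)
    by (unfold Rdiv; apply Rpow_mult_distr).
  assert (Hin : 0 < / (INR n + 1)) by (apply Rinv_0_lt_compat; lra).
  assert (Hhd : 0 < hi ^ d) by (apply pow_lt; assumption).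
  destruct k as [|j].
  - assert (Ed : d = n) by (unfold d; lia); rewrite Ed in *.
    rewrite bin_0; cbn [amplitude].
    set (A := sqrt (f1 0%nat x ^ 2 + f2 0%nat x ^ 2)).
    replace ((hi / sstar) ^ n * A * (Kw * (1 + hi) / (INR n + 1)))
      with (((hi / sstar) ^ n * (Kw * (1 + hi) / (INR n + 1))) * A) by ring.
    apply Rmult_le_compat_r; [apply sqrt_pos|].
    pose proof (weight_fact_le t lo hi n Hlo Ht) as X.
    replace (weight t n * (1 * (Kw * (/ sstar) ^ n * INR (fact n) ^ 2)))
      with ((Kw * (/ sstar) ^ n) * (weight t n * INR (fact n) ^ 2)) by ring.
    apply Rle_trans with ((Kw * (/ sstar) ^ n) * (hi ^ n / (INR n + 1))).
    + apply Rmult_le_compat_l; [apply Rmult_le_pos; lra | assumption].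
    + rewrite Erho.
      assert (0 <= Kw * (/ sstar) ^ n * (hi ^ n / (INR n + 1)) * hi).
      { apply Rmult_le_pos; [|lra]; apply Rmult_le_pos; [apply Rmult_le_pos; lra|].
        apply Rmult_le_pos; lra. }
      unfold Rdiv in *; lra.
  - assert (En : n = (S j + d)%nat) by (unfold d; lia).
    pose proof (weight_binomial_le t lo hi j d Hlo Ht) as X; rewrite <- En in X.
    cbn [amplitude]; unfold normalised.
    set (A := sqrt (f1 (S j) x ^ 2 + f2 (S j) x ^ 2)).
    assert (HA0 : 0 <= A) by apply sqrt_pos.
    replace (sqrt ((weight t j * f1 (S j) x) ^ 2 + (weight t j * f2 (S j) x) ^ 2))
      with (weight t j * A).
    2: { replace ((weight t j * f1 (S j) x) ^ 2 + (weight t j * f2 (S j) x) ^ 2)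
           with (weight t j ^ 2 * (f1 (S j) x ^ 2 + f2 (S j) x ^ 2)) by ring.
         rewrite sqrt_mult; [| apply pow2_ge_0 | apply sumsq_ge0].
         rewrite sqrt_pow2; [reflexivity | left; apply Hw]. }
    replace ((hi / sstar) ^ d * (weight t j * A) * (Kw * (1 + hi) / (INR n + 1)))
      with (((hi / sstar) ^ d * (Kw * (1 + hi) / (INR n + 1)) * weight t j) * A) by ring.
    apply Rmult_le_compat_r; [assumption|].
    replace (weight t n * (bin n (S j) * (Kw * (/ sstar) ^ d * INR (fact d) ^ 2)))
      with ((Kw * (/ sstar) ^ d) * (weight t n * (bin n (S j) * INR (fact d) ^ 2))) by ring.
    apply Rle_trans with ((Kw * (/ sstar) ^ d) * (hi / (INR n + 1) * hi ^ d * weight t j)).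
    + apply Rmult_le_compat_l; [apply Rmult_le_pos; lra | assumption].
    + rewrite Erho.
      assert (0 <= Kw * (/ sstar) ^ d * (/ (INR n + 1) * hi ^ d * weight t j)).
      { apply Rmult_le_pos; [apply Rmult_le_pos; lra|].
        apply Rmult_le_pos; [apply Rmult_le_pos; lra | left; apply Hw]. }
      unfold Rdiv in *; lra.
Qed.

(** Here [f + i g] stands for the solution and [v + i w] for the potential. *)
Lemma tower_of_solution (sr si lo hi sstar kap Kw : R) (t : nat -> R)
    (f g v w : nat -> R -> R) :
  0 < lo -> (forall n, lo <= t n <= hi) -> hi < sstar -> 0 <= Kw ->
  (forall n, Rabs (t (S (S n)) - t (S n)) <= kap / (INR n + 1)) ->
  jet f -> jet g -> jet v -> jet w ->
  (forall m x, in01 x -> Rabs (v m x) <= Kw * (/ sstar) ^ m * INR (fact m) ^ 2) ->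
  (forall m x, in01 x -> Rabs (w m x) <= Kw * (/ sstar) ^ m * INR (fact m) ^ 2) ->
  (forall x, in01 x -> x ^ 2 * f 2%nat x + (2 * x + sr) * f 1%nat x + (- si) * g 1%nat x
     = v 0%nat x * f 0%nat x - w 0%nat x * g 0%nat x) ->
  (forall x, in01 x -> x ^ 2 * g 2%nat x + (2 * x + sr) * g 1%nat x + si * f 1%nat x
     = v 0%nat x * g 0%nat x + w 0%nat x * f 0%nat x) ->
  tower sr si lo hi kap (8 * (Kw * (1 + hi)) ^ 2) (/ (1 - hi / sstar)) (hi / sstar) t
    (normalised t f) (normalised t g) (fun n x => memory (hi / sstar) t f g n x ^ 2).
Proof.
  intros Hlo Ht Hhi HKw Hstep Jf Jg Jv Jw Hv Hw Ef Eg.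
  pose proof (Ht 0%nat) as Ht0.
  assert (Hrho : 0 <= hi / sstar < 1).
  { split; [apply Rdiv_le_0_compat; lra|].
    apply Rmult_lt_reg_r with sstar; [lra|].
    replace (hi / sstar * sstar) with hi by (field; lra); lra. }
  assert (Hlot : forall n, lo <= t n) by (intros; apply Ht).
  pose proof (differentiated_equation f g (fun n x => leib v f n x - leib w g n x) sr (- si)
    Jf Jg (jet_minus _ _ (leib_jet _ _ Jv Jf) (leib_jet _ _ Jw Jg))) as Df.
  pose proof (differentiated_equation g f (fun n x => leib v g n x + leib w f n x) sr si
    Jg Jf (jet_plus _ _ (leib_jet _ _ Jv Jg) (leib_jet _ _ Jw Jf))) as Dg.
  assert (Ef' : forall x, in01 x ->
     x ^ 2 * f 2%nat x + (2 * x + sr) * f 1%nat x + - si * g 1%nat x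
     = leib v f 0 x - leib w g 0 x).
  { intros x Hx; rewrite (Ef x Hx); unfold leib; simpl; ring. }
  assert (Eg' : forall x, in01 x ->
     x ^ 2 * g 2%nat x + (2 * x + sr) * g 1%nat x + si * f 1%nat x
     = leib v g 0 x + leib w f 0 x).
  { intros x Hx; rewrite (Eg x Hx); unfold leib; simpl; ring. }
  specialize (Df Ef'); specialize (Dg Eg').
  destruct Jf as [Cf Df1], Jg as [Cg Dg1].
  assert (Cnf : forall n, cont01 (normalised t f n)) by (intros n; unfold normalised; cont01_tac).
  assert (Cng : forall n, cont01 (normalised t g n)) by (intros n; unfold normalised; cont01_tac).
  constructor; auto.
  - intros n; unfold memory.
    assert (Ca : forall k, cont01 (amplitude t f g k)).
    { intros [|k]; unfold amplitude; cont01_tac. }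
    cont01_tac.
  - intros n x Hx.
    replace ((INR n + 1) * (INR n + 2) / t (S n) * normalised t f (S n) x)
      with (weight t n * f (S (S n)) x)
      by (rewrite (weight_step t lo n Hlo Hlot); unfold normalised; ring).
    apply (is_derive_scal (f (S n))); auto.
  - intros n x Hx.
    replace ((INR n + 1) * (INR n + 2) / t (S n) * normalised t g (S n) x)
      with (weight t n * g (S (S n)) x)
      by (rewrite (weight_step t lo n Hlo Hlot); unfold normalised; ring).
    apply (is_derive_scal (g (S n))); auto.
  - intros n x Hx m.
    assert (Hm : 0 < m) by (unfold m; pose proof (pos_INR n); lra).
    pose proof (Hlot (S n)) as HtS; pose proof (Hlot (S (S n))) as HtSS.
    assert (W0 : t (S n) * weight t n = (m - 1) * m * weight t (S n)).
    { rewrite (weight_step t lo n Hlo Hlot); unfold m; field; lra. }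
    assert (W2 : m * (m + 1) / t (S (S n)) * weight t (S (S n)) = weight t (S n)).
    { rewrite (weight_step t lo (S n) Hlo Hlot), S_INR; unfold m; field; lra. }
    specialize (Df (S n) x Hx); specialize (Dg (S n) x Hx).
    rewrite S_INR in Df, Dg.
    replace (INR n + 1) with (m - 1) in Df, Dg by (unfold m; ring).
    assert (X1 : eqre sr si m x (t (S n)) (t (S (S n))) (normalised t f n x)
       (normalised t f (S n) x) (normalised t g (S n) x) (normalised t f (S (S n)) x)
       = weight t (S n) * leib v f (S n) x - weight t (S n) * leib w g (S n) x).
    { rewrite <- Rmult_minus_distr_l, <- Df; unfold eqre, normalised.
      replace (m * (m + 1) / t (S (S n)) * (weight t (S (S n)) * f (S (S (S n))) x))
        with ((m * (m + 1) / t (S (S n)) * weight t (S (S n))) * f (S (S (S n))) x) by ring.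
      replace (t (S n) * (weight t n * f (S n) x)) with ((t (S n) * weight t n) * f (S n) x)
        by ring.
      rewrite W0, W2; ring. }
    assert (X2 : eqim sr si m x (t (S n)) (t (S (S n))) (normalised t g n x)
       (normalised t f (S n) x) (normalised t g (S n) x) (normalised t g (S (S n)) x)
       = weight t (S n) * leib v g (S n) x + weight t (S n) * leib w f (S n) x).
    { rewrite <- Rmult_plus_distr_l, <- Dg; unfold eqim, normalised.
      replace (m * (m + 1) / t (S (S n)) * (weight t (S (S n)) * g (S (S (S n))) x))
        with ((m * (m + 1) / t (S (S n)) * weight t (S (S n))) * g (S (S (S n))) x) by ring.
      replace (t (S n) * (weight t n * g (S n) x)) with ((t (S n) * weight t n) * g (S n) x)
        by ring.
      rewrite W0, W2; ring. }
    rewrite X1, X2.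
    (* Each of the two components is a sum or difference of two products bounded by [B], whence
       [(2 B)^2 + (2 B)^2] and the constant [8]. *)
    set (B := Kw * (1 + hi) / m * memory (hi / sstar) t f g (S n) x).
    assert (Em : m = INR (S n) + 1) by (rewrite S_INR; unfold m; ring).
    assert (L1 : Rabs (weight t (S n) * leib v f (S n) x) <= B).
    { unfold B; rewrite Em; apply leib_weight_le with lo; auto; [lra|].
      intros k; apply Rabs_le_sqrt_l. }
    assert (L2 : Rabs (weight t (S n) * leib w g (S n) x) <= B).
    { unfold B; rewrite Em; apply leib_weight_le with lo; auto; [lra|].
      intros k; apply Rabs_le_sqrt_r. }
    assert (L3 : Rabs (weight t (S n) * leib v g (S n) x) <= B).
    { unfold B; rewrite Em; apply leib_weight_le with lo; auto; [lra|].
      intros k; apply Rabs_le_sqrt_r. }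
    assert (L4 : Rabs (weight t (S n) * leib w f (S n) x) <= B).
    { unfold B; rewrite Em; apply leib_weight_le with lo; auto; [lra|].
      intros k; apply Rabs_le_sqrt_l. }
    replace (8 * (Kw * (1 + hi)) ^ 2 / m ^ 2 * memory (hi / sstar) t f g (S n) x ^ 2)
      with ((2 * B) ^ 2 + (2 * B) ^ 2) by (unfold B; field; lra).
    apply Rplus_le_compat; rewrite <- (pow2_abs (_ + _)) || rewrite <- (pow2_abs (_ - _));
      apply pow_incr; (split; [apply Rabs_pos|]).
    + unfold Rminus; eapply Rle_trans; [apply Rabs_triang|]; rewrite Rabs_Ropp; lra.
    + eapply Rle_trans; [apply Rabs_triang|]; lra.
  - intros n x _; apply pow2_ge_0.
  - intros n x _; apply memory_sqr_step; assumption.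
Qed.

(** * Tapered radii *)

(* Equal to [hi] up to [N + 1], to [lo] from [2 (N + 1)] on, and of slope [O(1/n)]
   uniformly in [N] in between. *)
Definition taper (lo hi : R) (N n : nat) : R :=
  Rmax lo (Rmin hi (hi * (2 - INR n / (INR N + 1)))).

Lemma taper_bounds lo hi N n : lo <= hi -> lo <= taper lo hi N n <= hi.
Proof.
  intros H; unfold taper; split; [apply Rmax_l|].
  apply Rmax_lub; [assumption | apply Rmin_l].
Qed.

Lemma taper_small lo hi N n : 0 < hi -> lo <= hi -> (n <= S N)%nat -> taper lo hi N n = hi.
Proof.
  intros Hhi Hle Hn; unfold taper.
  pose proof (pos_INR N); apply le_INR in Hn; rewrite S_INR in Hn.
  assert (INR n / (INR N + 1) <= 1).
  { apply Rmult_le_reg_r with (INR N + 1); [lra|].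
    replace (INR n / (INR N + 1) * (INR N + 1)) with (INR n) by (field; lra); lra. }
  rewrite Rmin_left by nra; apply Rmax_right; assumption.
Qed.

Lemma taper_large lo hi N n : 0 < lo -> lo <= hi -> (2 * S N <= n)%nat -> taper lo hi N n = lo.
Proof.
  intros Hlo Hle Hn; unfold taper.
  pose proof (pos_INR N); apply le_INR in Hn; rewrite mult_INR, !S_INR in Hn; simpl INR in Hn.
  assert (2 <= INR n / (INR N + 1)).
  { apply Rmult_le_reg_r with (INR N + 1); [lra|].
    replace (INR n / (INR N + 1) * (INR N + 1)) with (INR n) by (field; lra); lra. }
  apply Rmax_left; eapply Rle_trans; [apply Rmin_r|]; nra.
Qed.

(** The radii move only while [n + 1 < 2 (N + 1)], and there the slope [hi / (N + 1)] is at most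
    [2 hi / (n + 1)]. *)
Lemma taper_step lo hi N n : 0 < lo -> lo <= hi ->
  Rabs (taper lo hi N (S (S n)) - taper lo hi N (S n)) <= 2 * hi / (INR n + 1).
Proof.
  intros Hlo Hle; pose proof (pos_INR N) as HN; pose proof (pos_INR n) as Hn.
  destruct (le_lt_dec (2 * S N) (S n)) as [H|H].
  - rewrite !taper_large by (assumption || lia).
    rewrite Rminus_diag, Rabs_R0; apply Rdiv_le_0_compat; lra.
  - apply lt_INR in H; rewrite mult_INR, !S_INR in H; simpl INR in H.
    assert (X : Rabs (taper lo hi N (S (S n)) - taper lo hi N (S n)) <= hi / (INR N + 1)).
    { unfold taper; rewrite !S_INR.
      assert (E : hi * (2 - (INR n + 1 + 1) / (INR N + 1))
                = hi * (2 - (INR n + 1) / (INR N + 1)) - hi / (INR N + 1)) by (field; lra).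
      rewrite E; set (z := hi * (2 - (INR n + 1) / (INR N + 1))).
      assert (0 < hi / (INR N + 1)) by (apply Rdiv_lt_0_compat; lra).
      unfold Rmax, Rmin; repeat destruct Rle_dec; unfold Rabs; destruct Rcase_abs; lra. }
    eapply Rle_trans; [exact X|].
    apply Rmult_le_reg_r with ((INR N + 1) * (INR n + 1)); [apply Rmult_lt_0_compat; lra|].
    replace (hi / (INR N + 1) * ((INR N + 1) * (INR n + 1))) with (hi * (INR n + 1))
      by (field; lra).
    replace (2 * hi / (INR n + 1) * ((INR N + 1) * (INR n + 1))) with (hi * (2 * (INR N + 1)))
      by (field; lra).
    apply Rmult_le_compat_l; lra.
Qed.

Lemma omega_const c n : omega (fun _ => c) n = c ^ n.
Proof. induction n as [|n IH]; simpl; [reflexivity | rewrite IH; reflexivity]. Qed.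

Lemma omega_taper_small lo hi N n : 0 < hi -> lo <= hi -> (n <= S N)%nat ->
  omega (taper lo hi N) n = hi ^ n.
Proof.
  intros Hhi Hle; induction n as [|n IH]; intros Hn; simpl; [reflexivity|].
  rewrite taper_small, IH by (assumption || lia); reflexivity.
Qed.

(** Fewer than [2 (N + 1)] factors can exceed [lo], each by a ratio of at most [hi / lo]. The
    constant may grow with [N]: it only serves to show, for fixed [N], that the energies tend to
    zero. *)
Lemma omega_taper_le lo hi N n : 0 < lo -> lo <= hi ->
  omega (taper lo hi N) n <= (hi / lo) ^ (2 * S N) * lo ^ n.
Proof.
  intros Hlo Hle.
  assert (Ht : forall k, lo <= taper lo hi N k <= hi) by (intros; apply taper_bounds; assumption).
  assert (Hq : 1 <= hi / lo).
  { apply Rmult_le_reg_r with lo; [assumption|].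
    replace (hi / lo * lo) with hi by (field; lra); lra. }
  destruct (le_lt_dec n (2 * S N)) as [Hn|Hn].
  - pose proof (omega_shift_le _ lo hi 0 n Hlo Ht) as X; rewrite Nat.add_0_r in X; simpl in X.
    rewrite Rmult_1_r in X; eapply Rle_trans; [exact X|].
    apply Rle_trans with ((hi / lo) ^ n * lo ^ n).
    + right; rewrite <- Rpow_mult_distr; f_equal; field; lra.
    + apply Rmult_le_compat_r; [apply pow_le; lra|]; apply Rle_pow; assumption.
  - assert (X : forall d, omega (taper lo hi N) (d + 2 * S N)
                 <= (hi / lo) ^ (2 * S N) * lo ^ (d + 2 * S N)).
    { induction d as [|d IH].
      - pose proof (omega_shift_le _ lo hi 0 (2 * S N) Hlo Ht) as X.
        rewrite Nat.add_0_r in X; cbn [omega] in X; rewrite Rmult_1_r in X.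
        eapply Rle_trans; [exact X|].
        right; rewrite <- Rpow_mult_distr; f_equal; field; lra.
      - change (S d + 2 * S N)%nat with (S (d + 2 * S N)); cbn [omega].
        rewrite taper_large by (assumption || lia).
        rewrite <- tech_pow_Rmult.
        apply Rle_trans with (lo * ((hi / lo) ^ (2 * S N) * lo ^ (d + 2 * S N)));
          [apply Rmult_le_compat_l; lra | right; ring]. }
    specialize (X (n - 2 * S N)%nat).
    replace (n - 2 * S N + 2 * S N)%nat with n in X by lia; exact X.
Qed.

(** * The kernel in terms of a single series *)

Lemma series_finite_le a b : (forall n, a n <= b n) -> series_finite b -> series_finite a.
Proof.
  intros H [M HM]; exists M; intros N.
  eapply Rle_trans; [apply sum_Rle; intros; apply H | apply HM].
Qed.

Lemma series_finite_plus a b :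
  series_finite a -> series_finite b -> series_finite (fun n => a n + b n).
Proof.
  intros [M HM] [M' HM']; exists (M + M'); intros N; rewrite sum_plus.
  apply Rplus_le_compat; auto.
Qed.

Lemma series_finite_scal c a : 0 <= c -> series_finite a -> series_finite (fun n => c * a n).
Proof.
  intros Hc [M HM]; exists (c * M); intros N.
  replace (sum_f_R0 (fun n => c * a n) N) with (c * sum_f_R0 a N).
  - apply Rmult_le_compat_l; auto.
  - rewrite scal_sum; apply sum_eq; intros; ring.
Qed.

Lemma series_finite_lim0 a : (forall n, 0 <= a n) -> series_finite a ->
  forall eps, 0 < eps -> exists M0, forall M, (M0 <= M)%nat -> a M < eps.
Proof.
  intros Ha [B HB] eps Heps.
  destruct (growing_cv (sum_f_R0 a)) as [l Hl].
  - intros n; rewrite tech5; pose proof (Ha (S n)); lra.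
  - exists B; intros x [n ->]; apply HB.
  - destruct (Hl (eps / 2) ltac:(lra)) as [N HN].
    exists (S N); intros [|M] HM; [lia|].
    pose proof (HN M ltac:(lia)) as H1; pose proof (HN (S M) ltac:(lia)) as H2.
    unfold Rdist in H1, H2; rewrite tech5 in H2.
    apply Rabs_def2 in H1; apply Rabs_def2 in H2; lra.
Qed.

Lemma series_finite_tail a n0 B : (forall n, 0 <= a n) ->
  (forall M, sum_f_R0 (fun i => a (S (n0 + i))) M <= B) -> series_finite a.
Proof.
  intros Ha HB; exists (sum_f_R0 a n0 + B); intros M.
  apply Rle_trans with (sum_f_R0 a (S (n0 + M))).
  - rewrite (tech2 a M (S (n0 + M))) by lia.
    assert (0 <= sum_f_R0 (fun i => a (S M + i)%nat) (S (n0 + M) - S M))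
      by (apply cond_pos_sum; auto).
    lra.
  - rewrite (tech2 a n0 (S (n0 + M))) by lia.
    replace (S (n0 + M) - S n0)%nat with M by lia.
    apply Rplus_le_compat_l, HB.
Qed.

Definition dre (D : nat -> R -> Cx) (n : nat) (x : R) : R := Cre (D n x).
Definition dim (D : nat -> R -> Cx) (n : nat) (x : R) : R := Cim (D n x).

Definition total_energy (D : nat -> R -> Cx) (n : nat) : R :=
  energy (fun k => dre D (S k)) (fun k => dim D (S k)) n.

Lemma gcoef_weight sigma n : gcoef sigma n = weight (fun _ => sigma) n ^ 2.
Proof.
  unfold gcoef, weight; rewrite omega_const, Nat.mul_comm, pow_mult.
  pose proof (INR_fact_pos n); pose proof (INR_fact_pos (S n)); field; lra.
Qed.

Lemma gcoef_ge0 sigma n : 0 <= gcoef sigma n.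
Proof. rewrite gcoef_weight; apply pow2_ge_0. Qed.

Lemma gcoef_mono sigma sigma' n : 0 < sigma -> sigma < sigma' -> gcoef sigma n <= gcoef sigma' n.
Proof.
  intros H0 H; unfold gcoef, Rdiv; apply Rmult_le_compat_r.
  - pose proof (INR_fact_pos n); pose proof (INR_fact_pos (S n)).
    left; apply Rinv_0_lt_compat, Rmult_lt_0_compat; apply pow_lt; assumption.
  - apply pow_incr; lra.
Qed.

Lemma energy_normalised t f g n :
  cont01 (f (S n)) -> cont01 (g (S n)) ->
  energy (normalised t f) (normalised t g) n
  = weight t n ^ 2 * energy (fun k => f (S k)) (fun k => g (S k)) n.
Proof.
  intros Hf Hg; unfold energy, bulk, trace0, normalised.
  rewrite Rmult_plus_distr_l, <- I01_scal by cont01_tac.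
  f_equal; [apply I01_ext; intros x _; ring | ring].
Qed.

Lemma norm_weight_le sigma n k x : 0 < sigma -> (k <= 2)%nat -> in01 x ->
  INR n ^ k * (x / sigma) ^ k <= (/ sigma) ^ k * (1 + ((INR n + 1) * x) ^ 2).
Proof.
  intros Hs Hk [Hx0 Hx1].
  replace (INR n ^ k * (x / sigma) ^ k) with ((/ sigma) ^ k * (INR n * x) ^ k)
    by (rewrite <- !Rpow_mult_distr; f_equal; unfold Rdiv; ring).
  apply Rmult_le_compat_l.
  { apply pow_le; left; apply Rinv_0_lt_compat; assumption. }
  pose proof (pos_INR n).
  assert (H1 : 0 <= INR n * x <= (INR n + 1) * x) by (split; nra).
  assert (H2 : (INR n * x) ^ 2 <= ((INR n + 1) * x) ^ 2) by (apply pow_incr; assumption).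
  destruct k as [|[|[|k]]]; [| | | lia].
  - rewrite pow_O; pose proof (pow2_ge_0 ((INR n + 1) * x)); lra.
  - rewrite pow_1; pose proof (pow2_ge_0 (INR n * x - 1)).
    nra.
  - lra.
Qed.

(** For [n >= 1] one has [n + 1 <= 2 n]. At [n = 0] the weighted norm vanishes, but [x <= 1] lets
    the unweighted one suffice. *)
Lemma weight_le_norm sigma n x : 0 < sigma -> in01 x ->
  1 + ((INR n + 1) * x) ^ 2
  <= 2 * (INR n ^ 0 * (x / sigma) ^ 0) + 4 * sigma ^ 2 * (INR n ^ 2 * (x / sigma) ^ 2).
Proof.
  intros Hs [Hx0 Hx1].
  replace (4 * sigma ^ 2 * (INR n ^ 2 * (x / sigma) ^ 2)) with (4 * (INR n * x) ^ 2)
    by (field; lra).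
  rewrite !pow_O.
  destruct n as [|n].
  - simpl INR; assert (x ^ 2 <= 1 ^ 2) by (apply pow_incr; lra); nra.
  - assert (1 <= INR (S n)) by (apply (le_INR 1); lia).
    assert (((INR (S n) + 1) * x) ^ 2 <= (2 * INR (S n) * x) ^ 2).
    { apply pow_incr; split; nra. }
    nra.
Qed.

Lemma norm_finite_iff sigma k D : (forall n, cont01 (dre D n)) -> (forall n, cont01 (dim D n)) ->
  norm_finite sigma k (shiftD D) <->
  series_finite (fun n => gcoef sigma n *
    I01 (fun x => INR n ^ k * (x / sigma) ^ k * (dre D (S n) x ^ 2 + dim D (S n) x ^ 2))).
Proof.
  intros Cr Ci.
  assert (C : forall n, cont01 (fun x => INR n ^ k * (x / sigma) ^ k
                              * (dre D (S n) x ^ 2 + dim D (S n) x ^ 2)))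
    by (intros n; cont01_tac).
  split.
  - intros [I [HI HS]].
    apply series_finite_le with (2 := HS); intros n.
    rewrite (integral01_unique _ _ (C n) (HI n)); apply Rle_refl.
  - intros HS; eexists; split; [|exact HS].
    intros n; apply (integral01_I01 _ (C n)).
Qed.

(** The energy is comparable to the norms with [k = 0] and [k = 2] plus the boundary term, and it
    dominates the norm with [k = 1]. The requirement that [L_s u] lie in [Y] is automatic for a
    solution. *)
Lemma in_kernel_iff sigma s W u : 0 < sigma ->
  in_kernel sigma s W u <->
  exists D, derivs u D /\ u 1 = C0 /\ (forall x, in01 x -> Lop s W D x = C0) /\
    series_finite (fun n => gcoef sigma n * total_energy D n).
Proof.
  intros Hs; split.
  - intros [[D [[HD [H1 [N0 [_ [N2 HB]]]]] _]] [D2 [HD2 HL]]].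
    exists D; split; [assumption|]; split; [assumption|]; split.
    + intros x Hx; rewrite <- (HL x Hx); unfold Lop.
      rewrite !(derivs_unique u D D2 HD HD2) by assumption; reflexivity.
    + destruct (derivs_jet u D HD) as [[Cr _] [Ci _]].
      change (forall n, cont01 (dre D n)) in Cr; change (forall n, cont01 (dim D n)) in Ci.
      apply norm_finite_iff in N0; [|assumption|assumption].
      apply norm_finite_iff in N2; [|assumption|assumption].
      unfold bdry_finite in HB.
      apply (series_finite_scal 2) in N0; [|lra].
      apply (series_finite_scal (4 * sigma ^ 2)) in N2; [|pose proof (pow2_ge_0 sigma); lra].
      apply (series_finite_scal (/ sigma)) in HB; [|left; apply Rinv_0_lt_compat; assumption].
      eapply series_finite_le;
        [|exact (series_finite_plus _ _ (series_finite_plus _ _ N0 N2) HB)].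
      intros n; cbv beta; unfold total_energy, energy; rewrite Rmult_plus_distr_l.
      apply Rplus_le_compat.
      * set (g0 := fun x => INR n ^ 0 * (x / sigma) ^ 0 * (dre D (S n) x ^ 2 + dim D (S n) x ^ 2)).
        set (g2 := fun x => INR n ^ 2 * (x / sigma) ^ 2 * (dre D (S n) x ^ 2 + dim D (S n) x ^ 2)).
        assert (Cg0 : cont01 g0) by (unfold g0; cont01_tac).
        assert (Cg2 : cont01 g2) by (unfold g2; cont01_tac).
        replace (2 * (gcoef sigma n * I01 g0) + 4 * sigma ^ 2 * (gcoef sigma n * I01 g2))
          with (gcoef sigma n * (2 * I01 g0 + 4 * sigma ^ 2 * I01 g2)) by ring.
        apply Rmult_le_compat_l; [apply gcoef_ge0|].
        rewrite <- !I01_scal, <- I01_plus by cont01_tac.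
        apply I01_le; [apply (bulk_cont (fun k => dre D (S k)) (fun k => dim D (S k))); auto
                      | cont01_tac |].
        intros x Hx; unfold g0, g2.
        pose proof (Rmult_le_compat_r _ _ _ (sumsq_ge0 (dre D (S n) x) (dim D (S n) x))
          (weight_le_norm sigma n x Hs Hx)); lra.
      * right; unfold gcoef, trace0, shiftD, Cnorm2, dre, dim.
        rewrite pow_add, pow_1; field.
        repeat split; try apply INR_fact_neq_0; lra.
  - intros [D [HD [H1 [HL HS]]]].
    destruct (derivs_jet u D HD) as [[Cr _] [Ci _]].
    change (forall n, cont01 (dre D n)) in Cr; change (forall n, cont01 (dim D n)) in Ci.
    assert (His : 0 < / sigma) by (apply Rinv_0_lt_compat; assumption).
    assert (HN : forall k, (k <= 2)%nat -> norm_finite sigma k (shiftD D)).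
    { intros k Hk; apply norm_finite_iff; [assumption|assumption|].
      apply (series_finite_scal ((/ sigma) ^ k)) in HS; [|apply pow_le; lra].
      apply series_finite_le with (2 := HS); intros n; cbv beta.
      rewrite (Rmult_comm (gcoef sigma n) (total_energy D n)), <- Rmult_assoc, Rmult_comm.
      apply Rmult_le_compat_r; [apply gcoef_ge0|].
      apply Rle_trans with ((/ sigma) ^ k * bulk (fun k => dre D (S k)) (fun k => dim D (S k)) n).
      - unfold bulk; rewrite <- I01_scal by cont01_tac.
        apply I01_le; [cont01_tac | cont01_tac |]; intros x Hx.
        rewrite <- Rmult_assoc; apply Rmult_le_compat_r; [apply sumsq_ge0|].
        apply norm_weight_le; assumption.
      - apply Rmult_le_compat_l; [apply pow_le; lra|].
        unfold total_energy, energy.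
        pose proof (trace0_ge0 (fun k => dre D (S k)) (fun k => dim D (S k)) n); lra. }
    assert (HB : bdry_finite sigma (shiftD D)).
    { unfold bdry_finite; apply (series_finite_scal sigma) in HS; [|lra].
      apply series_finite_le with (2 := HS); intros n; cbv beta.
      apply Rle_trans with (sigma * (gcoef sigma n
           * trace0 (fun k => dre D (S k)) (fun k => dim D (S k)) n)).
      - right; unfold gcoef, trace0, shiftD, Cnorm2, dre, dim.
        rewrite pow_add, pow_1; field; split; apply INR_fact_neq_0.
      - apply Rmult_le_compat_l; [lra|]; apply Rmult_le_compat_l; [apply gcoef_ge0|].
        unfold total_energy, energy.
        assert (0 <= bulk (fun k => dre D (S k)) (fun k => dim D (S k)) n)
          by (apply bulk_ge0; auto).
        lra. }
    split; [|exists D; split; assumption].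
    exists D; split.
    { split; [assumption|]; split; [assumption|]; repeat split; auto. }
    (* The derivative sequence of [L_s u], which vanishes on the interval. *)
    set (Z := fun (n : nat) (x : R) => C0).
    assert (HNZ : forall k, norm_finite sigma k Z).
    { intros k; exists (fun _ => 0); split.
      - intros n; exists (fun _ => 0); split; [|ring].
        intros x _; apply is_derive_has_deriv01R.
        replace (INR n ^ k * (x / sigma) ^ k * Cnorm2 (Z n x)) with 0
          by (unfold Z, Cnorm2, C0, Cre, Cim; simpl; ring).
        apply (is_derive_const (K := R_AbsRing) (V := R_NormedModule)).
      - exists 0; intros N; right; apply sum_eq_R0; intros; ring. }
    exists Z; split; [|split; [apply HNZ | split; [apply HNZ|]]].
    + split.
      * intros x Hx; rewrite HL by assumption; reflexivity.
      * intros n x _ eps Heps; exists 1; split; [lra|]; intros h _ _ _.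
        unfold Z, Cmod, Cnorm2, Csub, Cscal, C0, Cre, Cim; simpl.
        replace (_ + _) with 0 by ring; rewrite sqrt_0; assumption.
    + exists 0; intros N; right; apply sum_eq_R0; intros n _.
      unfold Z, Cnorm2, C0, Cre, Cim; simpl; ring.
Qed.

(** * Comparison of the kernels at the two radii *)

Lemma total_energy_ge0 u D n : derivs u D -> 0 <= total_energy D n.
Proof.
  intros HD; destruct (derivs_jet u D HD) as [[Cr _] [Ci _]].
  apply (energy_ge0 (fun k => dre D (S k)) (fun k => dim D (S k)));
    [exact (Cr (S n)) | exact (Ci (S n))].
Qed.

Lemma kernel_decreasing sigma sigma' s W u : 0 < sigma -> sigma < sigma' ->
  in_kernel sigma' s W u -> in_kernel sigma s W u.
Proof.
  intros H0 Hlt H; apply in_kernel_iff in H; [|lra]; apply in_kernel_iff; [assumption|].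
  destruct H as [D [HD [H1 [HL HS]]]]; exists D; repeat split; try assumption; try apply HD.
  apply series_finite_le with (2 := HS); intros n.
  apply Rmult_le_compat_r; [apply total_energy_ge0 with u; assumption|].
  apply gcoef_mono; assumption.
Qed.

Lemma weight_ext t t' n : omega t n = omega t' n -> weight t n = weight t' n.
Proof. intros E; unfold weight; rewrite E; reflexivity. Qed.

Lemma energy_taper_small lo hi N f g n : 0 < hi -> lo <= hi -> (n <= S N)%nat ->
  cont01 (f (S n)) -> cont01 (g (S n)) ->
  energy (normalised (taper lo hi N) f) (normalised (taper lo hi N) g) n
  = gcoef hi n * energy (fun k => f (S k)) (fun k => g (S k)) n.
Proof.
  intros Hhi Hle Hn Hf Hg; rewrite energy_normalised, gcoef_weight by assumption.
  rewrite (weight_ext (taper lo hi N) (fun _ => hi)); [reflexivity|].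
  rewrite omega_taper_small, omega_const by assumption; reflexivity.
Qed.

Lemma energy_taper_le lo hi N f g n : 0 < lo -> lo <= hi ->
  cont01 (f (S n)) -> cont01 (g (S n)) ->
  energy (normalised (taper lo hi N) f) (normalised (taper lo hi N) g) n
  <= ((hi / lo) ^ (2 * S N)) ^ 2
     * (gcoef lo n * energy (fun k => f (S k)) (fun k => g (S k)) n).
Proof.
  intros Hlo Hle Hf Hg; rewrite energy_normalised, gcoef_weight by assumption.
  rewrite <- Rmult_assoc; apply Rmult_le_compat_r.
  { apply (energy_ge0 (fun k => f (S k)) (fun k => g (S k))); assumption. }
  rewrite <- Rpow_mult_distr; apply pow_incr; split.
  - left; apply weight_pos with lo; [assumption|]; intros k; apply taper_bounds; assumption.
  - unfold weight; rewrite omega_const; unfold Rdiv; rewrite <- Rmult_assoc.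
    apply Rmult_le_compat_r.
    + left; apply Rinv_0_lt_compat, Rmult_lt_0_compat; apply INR_fact_pos.
    + apply omega_taper_le; assumption.
Qed.

(** The forcing of order [n] sees the radii only up to that order, so before the taper begins it
    does not depend on [N]. *)
Lemma memory_ext rho t t' f g n x : (forall k, (k <= n)%nat -> omega t k = omega t' k) ->
  memory rho t f g n x = memory rho t' f g n x.
Proof.
  intros E; apply sum_eq; intros [|k] Hk; [reflexivity|]; unfold amplitude, normalised.
  rewrite (weight_ext t t') by (apply E; lia); reflexivity.
Qed.

(* The weights of radius [sigma'] are tapered beyond order [N] so that the a priori
   finiteness at radius [sigma] applies; the resulting bound does not depend on [N]. *)
Lemma kernel_increasing W sigma_star sigma sigma' s u :
  gevrey_regular sigma_star 2 W ->
  0 < sigma -> sigma < sigma' -> sigma' < sigma_star ->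
  Omega sigma s -> Omega sigma' s ->
  in_kernel sigma s W u -> in_kernel sigma' s W u.
Proof.
  intros [V [HV [K HK]]] H0 Hlt Hst Om Om' Hker.
  apply in_kernel_iff in Hker; [|assumption]; apply in_kernel_iff; [lra|].
  destruct Hker as [D [HD [H1 [HL HS]]]].
  exists D; split; [assumption|]; split; [assumption|]; split; [assumption|].
  (* Read off the Gevrey bound for [n = 0] at [x = 0], whose right-hand side is [K]. *)
  assert (HK0 : 0 <= K).
  { assert (I0 : in01 0) by (unfold in01; lra).
    specialize (HK 0%nat 0 I0); cbn [fact INR pow] in HK.
    unfold Rpower in HK; rewrite ln_1, Rmult_0_r, exp_0 in HK.
    pose proof (sqrt_pos (Cnorm2 (V 0%nat 0))); unfold Cmod in HK; lra. }
  assert (Hpow : forall m, Rpower (INR (fact m)) 2 = INR (fact m) ^ 2).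
  { intros m; replace 2 with (INR 2) by (simpl; ring).
    apply Rpower_pow, INR_fact_pos. }
  destruct (derivs_jet u D HD) as [Jf Jg], (derivs_jet W V HV) as [Jv Jw].
  change (jet (dre D)) in Jf; change (jet (dim D)) in Jg;
    change (jet (dre V)) in Jv; change (jet (dim V)) in Jw.
  pose proof (proj1 Jf) as Cf; pose proof (proj1 Jg) as Cg.
  assert (Hv : forall m x, in01 x ->
     Rabs (dre V m x) <= K * (/ sigma_star) ^ m * INR (fact m) ^ 2).
  { intros m x Hx; rewrite <- Hpow.
    eapply Rle_trans; [apply Rabs_Cre_le | apply HK; assumption]. }
  assert (Hw : forall m x, in01 x ->
     Rabs (dim V m x) <= K * (/ sigma_star) ^ m * INR (fact m) ^ 2).
  { intros m x Hx; rewrite <- Hpow.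
    eapply Rle_trans; [apply Rabs_Cim_le | apply HK; assumption]. }
  assert (Ef : forall x, in01 x ->
     x ^ 2 * dre D 2 x + (2 * x + Cre s) * dre D 1 x + - Cim s * dim D 1 x
     = dre V 0 x * dre D 0 x - dim V 0 x * dim D 0 x).
  { intros x Hx; pose proof (f_equal Cre (HL x Hx)) as E.
    unfold Lop, dre, dim in *; rewrite (proj1 HV x Hx).
    unfold Csub, Cadd, Cscal, Cmul, C0, Cre, Cim in *; cbn [fst snd] in *; lra. }
  assert (Eg : forall x, in01 x ->
     x ^ 2 * dim D 2 x + (2 * x + Cre s) * dim D 1 x + Cim s * dre D 1 x
     = dre V 0 x * dim D 0 x + dim V 0 x * dre D 0 x).
  { intros x Hx; pose proof (f_equal Cim (HL x Hx)) as E.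
    unfold Lop, dre, dim in *; rewrite (proj1 HV x Hx).
    unfold Csub, Cadd, Cscal, Cmul, C0, Cre, Cim in *; cbn [fst snd] in *; lra. }
  set (rho := sigma' / sigma_star).
  assert (Hrho : 0 <= rho < 1).
  { unfold rho; split; [apply Rdiv_le_0_compat; lra|].
    apply Rmult_lt_reg_r with sigma_star; [lra|].
    replace (sigma' / sigma_star * sigma_star) with sigma' by (field; lra); lra. }
  (* [2 * sigma'] is the slope constant of [taper_step]; the next two constants are those of
     [tower_of_solution]. *)
  destruct (tower_energy_bound s sigma sigma' (2 * sigma') (8 * (K * (1 + sigma')) ^ 2)
              (/ (1 - rho)) rho) as [n0 [A [HA Hbound]]]; try lra.
  { apply Omega_admissible; assumption. }
  { pose proof (pow2_ge_0 (K * (1 + sigma'))); lra. }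
  { left; apply Rinv_0_lt_compat; lra. }
  assert (HE0 : forall n, 0 <= total_energy D n)
    by (intros n; apply total_energy_ge0 with u; assumption).
  set (h2 := fun n x => memory rho (fun _ => sigma') (dre D) (dim D) n x ^ 2).
  set (E := fun n => gcoef sigma' n * total_energy D n).
  apply (series_finite_tail _ n0 (A * (E n0 + E (S n0) + forcing h2 n0))).
  { intros n; apply Rmult_le_pos; [apply gcoef_ge0 | apply HE0]. }
  intros M; fold E.
  (* The taper begins beyond every order in the partial sum, so on both sides of the bound the
     tapered energies agree with those at radius [sigma']. *)
  set (N := S (n0 + M)).
  set (t := taper sigma sigma' N).
  assert (HT : tower (Cre s) (Cim s) sigma sigma' (2 * sigma') (8 * (K * (1 + sigma')) ^ 2)
     (/ (1 - rho)) rho t (normalised t (dre D)) (normalised t (dim D))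
     (fun n x => memory rho t (dre D) (dim D) n x ^ 2)).
  { apply tower_of_solution with (v := dre V) (w := dim V); try assumption.
    - intros n; apply taper_bounds; lra.
    - intros n; apply taper_step; lra. }
  specialize (Hbound _ _ _ _ HT).
  assert (Hsmall : forall n, (n <= S N)%nat ->
     energy (normalised t (dre D)) (normalised t (dim D)) n = E n).
  { intros n Hn; apply energy_taper_small; auto; lra. }
  assert (Hlim : forall eps, 0 < eps -> exists M0, forall M, (M0 <= M)%nat ->
     energy (normalised t (dre D)) (normalised t (dim D)) M < eps).
  { set (C := ((sigma' / sigma) ^ (2 * S N)) ^ 2).
    assert (HC : 0 <= C) by apply pow2_ge_0.
    intros eps Heps.
    destruct (series_finite_lim0 (fun n => C * (gcoef sigma n * total_energy D n)))
      with (eps := eps) as [M0 HM0]; auto.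
    - intros n; apply Rmult_le_pos; [assumption|].
      apply Rmult_le_pos; [apply gcoef_ge0 | apply HE0].
    - apply series_finite_scal; assumption.
    - exists M0; intros M' HM'; eapply Rle_lt_trans; [|apply (HM0 M' HM')].
      apply energy_taper_le; auto; lra. }
  specialize (Hbound Hlim M).
  rewrite !Hsmall in Hbound by (unfold N; lia).
  assert (EF : forcing (fun n x => memory rho t (dre D) (dim D) n x ^ 2) n0 = forcing h2 n0).
  { assert (X : forall x, memory rho t (dre D) (dim D) n0 x
                        = memory rho (fun _ => sigma') (dre D) (dim D) n0 x).
    { intros x; apply memory_ext; intros k Hk; rewrite omega_const.
      apply omega_taper_small; try lra; unfold N; lia. }
    unfold forcing, h2; rewrite X; f_equal.
    apply I01_ext; intros x _; rewrite X; reflexivity. }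
  rewrite EF in Hbound.
  eapply Rle_trans; [right | exact Hbound].
  apply sum_eq; intros i Hi; symmetry; apply Hsmall; unfold N; lia.
Qed.

Lemma has_dim_ext (P Q : (R -> Cx) -> Prop) d :
  (forall u, P u <-> Q u) -> has_dim P d -> has_dim Q d.
Proof.
  intros E [b [H1 [H2 H3]]]; exists b; split; [|split].
  - intros i Hi; apply E, H1, Hi.
  - exact H2.
  - intros u Hu; apply H3, E, Hu.
Qed.

Theorem mainTheorem14 (W : R -> Cx) (sigma_star sigma sigma' : R) (s : Cx) :
  gevrey_regular sigma_star 2 W ->
  0 < sigma -> sigma < sigma' -> sigma' < sigma_star ->
  Omega sigma s -> Omega sigma' s ->
  forall d : nat,
    has_dim (in_kernel sigma s W) d <-> has_dim (in_kernel sigma' s W) d.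
Proof.
  intros HW H0 H1 H2 Om Om' d.
  assert (E : forall u, in_kernel sigma s W u <-> in_kernel sigma' s W u).
  { intros u; split.
    - apply kernel_increasing with sigma_star; assumption.
    - apply kernel_decreasing; assumption. }
  split; apply has_dim_ext; [assumption|].
  intros u; symmetry; apply E.
Qed.
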